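(* Let $G$ be a planar graph embedded in the plane, let $k\ge 1$ be an integer, and let $(G,H,r,c)$ be a multiflow instance satisfying the cut condition, such that every demand edge $h\in E(H)$ has both endpoints on the boundary of a common face of $G$, and the boundary of every face of $G$ contains at most $k$ terminals. Then the congestion of $(G,H,r,c)$ is at most $2\lceil \log_2 k\rceil + 2$; that is, there is a multiflow in $G$ that, for every demand edge $st\in E(H)$, routes $r(st)$ units of flow between $s$ and $t$ along $s$–$t$ paths of $G$, such that for every edge $e\in E(G)$ the total flow through $e$ is at most $(2\lceil \log_2 k\rceil + 2)\,c(e)$.
   Context: A multiflow instance $(G,H,r,c)$ consists of a supply graph $G$, a demand graph $H$ on the vertex set $V(G)$ (its edges are the demands), nonnegative capacities $c:E(G)\to\mathbb{R}_{\ge 0}$ and positive requests $r:E(H)\to\mathbb{R}_{>0}$. A terminal is a vertex incident to some demand edge. The instance satisfies the cut condition if for every $X\subseteq V(G)$, $\sum_{e\in\delta_G(X)} c(e)\ge \sum_{h\in\delta_H(X)} r(h)$. The congestion of an instance satisfying the cut condition is the smallest $\lambda\ge 1$ such that a multiflow routing every demand $h$ with value $r(h)$ exists when each capacity $c(e)$ is replaced by $\lambda c(e)$. *)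

(* Defs.v *)
From HB Require Import structures.
From mathcomp Require Import all_boot all_order all_algebra all_fingroup.
Set Implicit Arguments. Unset Strict Implicit. Unset Printing Implicit Defensive.
Import Order.TTheory GRing.Theory Num.Theory.

(* Graphs: a finite vertex type V, a finite edge type E with endpoint map
   [ends : E -> V * V] (parallel edges and loops allowed).  Edge e is
   undirected; its two darts (half-edges) are (e,false) : ends.1 -> ends.2
   and (e,true) : ends.2 -> ends.1. *)
Section Graph.
Variables (V E : finType) (ends : E -> V * V).

Local Notation dart := (E * bool)%type.
Definition dtail (d : dart) : V := if d.2 then (ends d.1).2 else (ends d.1).1.
Definition dhead (d : dart) : V := if d.2 then (ends d.1).1 else (ends d.1).2.
Definition drev (d : dart) : dart := (d.1, ~~ d.2).

Definition incident (v : V) (e : E) : bool := ((ends e).1 == v) || ((ends e).2 == v).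
Definition isolated (v : V) : bool := [forall e, ~~ incident v e].
Definition adj : rel V := fun u w =>
  [exists e, (ends e == (u, w)) || (ends e == (w, u))].
Definition ncomp : nat := n_comp adj [pred x : V | true].

(* Combinatorial embedding (rotation system): sigma permutes the darts,
   preserves tails, and acts cyclically (one orbit) on the darts at each vertex. *)
Definition rotation (sigma : {perm dart}) : Prop :=
  (forall d, dtail (sigma d) = dtail d) /\
  (forall d d', dtail d = dtail d' -> fconnect sigma d d').

Definition facemap (sigma : {perm dart}) (d : dart) : dart := sigma (drev d).
Definition dfaces (sigma : {perm dart}) : {set {set dart}} :=
  [set [set d' | fconnect (facemap sigma) d d'] | d : dart].

(* Planar (genus 0) embedding: Euler's formula  V - E + F = 2 * #components,
   where each isolated vertex counts as its own component with one face. *)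
Definition planar_rotation (sigma : {perm dart}) : Prop :=
  rotation sigma /\
  #|V| + #|dfaces sigma| + #|[set v | isolated v]| = #|E| + 2 * ncomp.

Definition face_boundary (sigma : {perm dart}) (B : {set V}) : Prop :=
  (exists2 F, F \in dfaces sigma & B = [set dtail d | d in F]) \/
  (exists2 v, isolated v & B = [set v]).

Fixpoint walk (s : V) (p : seq dart) (t : V) : bool :=
  match p with
  | [::] => s == t
  | d :: p' => (dtail d == s) && walk (dhead d) p' t
  end.
Definition stpath (s t : V) (p : seq dart) : bool :=
  walk s p t && uniq (s :: map dhead p).

Definition load (R : numDomainType) (p : seq dart) (w : R) (e : E) : R :=
  w *+ count (fun d : dart => d.1 == e) p.
End Graph.

Section Multiflow.
Variables (R : realFieldType) (V E D : finType)
  (ends : E -> V * V) (dem : D -> V * V) (c : E -> R) (r : D -> R).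
Local Open Scope ring_scope.

Definition crossing (X : {set V}) (uv : V * V) : bool := (uv.1 \in X) != (uv.2 \in X).

Definition cut_condition : Prop :=
  forall X : {set V},
    \sum_(h : D | crossing X (dem h)) r h <= \sum_(e : E | crossing X (ends e)) c e.

Definition terminal (v : V) : bool := [exists h, (v == (dem h).1) || (v == (dem h).2)].

Definition routable (lam : R) : Prop :=
  exists P : D -> seq (seq (E * bool) * R),
    (forall h, all (fun pw => stpath ends (dem h).1 (dem h).2 pw.1 && (0 <= pw.2)) (P h)) /\
    (forall h, \sum_(pw <- P h) pw.2 = r h) /\
    (forall e, \sum_(h : D) \sum_(pw <- P h) load pw.1 pw.2 e <= lam * c e).
End Multiflow.

(* Main.v *)
(* By linear programming duality it is enough to show, for nonnegative edge
   lengths, that the sum of r(h) dist(h) over the demands is at most 2L+1 times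
   the sum of c(e) len(e), where L = ceil(log2 k).

   Suppose first that the demands are weighted chords drawn in the faces of G
   without crossings, and satisfy the cut condition.  Adding the chords to G
   leaves the graph planar.  A set of dual edges is a T-join for the T prescribed
   by the chords in a parity class of the dual exactly when it differs from the
   set of chords by a cut, so the cut condition says that the chords form a
   minimum T-join in the dual.  The packing of T-cuts provided by Edmonds and
   Johnson is then a packing of cycles through exactly one chord each, which
   bounds the sum of w dist over the chords by the sum of c(e) len(e).

   In general, consider the demands assigned to one face.  The shortest paths
   between interlaced pairs of corners meet, so the distances between the corners
   of the face satisfy the Kalmanson inequalities and are nonnegative
   combinations of the splits of the boundary cycle into two intervals.  Hence
   these demands may be replaced by 2L+1 systems of noncrossing chords such that
   on every split each system separates at most as much as the demands do, and
   all systems together at least as much.  Such systems are obtained by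
   recursively halving the terminals of the face: the demands crossing the middle
   of a block are replaced by a nested matching, plus chord systems in either half
   measuring how far a position is from being indistinguishable from one of the
   other half.  Choosing one system in every face gives a noncrossing instance;
   the cut condition needs to be checked only for cuts that are simple dual
   cycles, which cross each face boundary at most twice, and follows there from
   the cut condition for the demands. *)

Require Import Defs.
From HB Require Import structures.
From mathcomp Require Import all_boot all_order all_algebra all_fingroup.
From mathcomp Require Import zify ring lra.
Import Order.TTheory GRing.Theory Num.Theory.
Local Open Scope ring_scope.

Set Implicit Arguments. Unset Strict Implicit. Unset Printing Implicit Defensive.

Lemma crossingE (V : finType) (X : {set V}) uv :
  crossing X uv = (uv.1 \in X) (+) (uv.2 \in X).
Proof. by rewrite /crossing; case: (_ \in _); case: (_ \in _). Qed.

Definition symd (T : finType) (A B : {set T}) : {set T} :=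
  [set x | (x \in A) (+) (x \in B)].

(** * Edge sets joining two vertices *)

Section SymDiff.
Variable T : finType.
Implicit Types A B C : {set T}.

Lemma in_symd A B x : (x \in symd A B) = (x \in A) (+) (x \in B).
Proof. by rewrite inE. Qed.

Lemma symdC A B : symd A B = symd B A.
Proof. by apply/setP => x; rewrite !inE addbC. Qed.

Lemma symdA A B C : symd A (symd B C) = symd (symd A B) C.
Proof. by apply/setP => x; rewrite !inE addbA. Qed.

Lemma symdKl A B : symd A (symd A B) = B.
Proof. by apply/setP => x; rewrite !inE addKb. Qed.

Lemma symd_sub A B : A \subset B -> symd B A = B :\: A.
Proof.
move=> sAB; apply/setP => x; rewrite !inE.
by case: (boolP (x \in A)) => [/(subsetP sAB) ->|_]; rewrite ?addbF.
Qed.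

End SymDiff.

Section Parity.
Variables (N E : finType) (ends : E -> N * N).
Implicit Types (P Q : {set E}) (U W : {set N}) (a b x y z : N).

Definition par P U := \big[addb/false]_(e : E) ((e \in P) && crossing U (ends e)).

Lemma par_symd P Q U : par (symd P Q) U = par P U (+) par Q U.
Proof.
rewrite /par -big_split; apply: eq_bigr => e _.
by rewrite in_symd; case: (e \in P); case: (e \in Q); case: (crossing _ _).
Qed.

Lemma par_card P U : par P U = odd #|[set e in P | crossing U (ends e)]|.
Proof.
rewrite -sum1_card (big_morph odd oddD (erefl _)) /par.
rewrite (eq_bigr (fun e => if (e \in P) && crossing U (ends e) then true else false)); last first.
  by move=> e _; case: (_ && _).
by rewrite -big_mkcond; apply: eq_bigl => e; rewrite inE.
Qed.

Lemma par0 U : par set0 U = false.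
Proof. by rewrite /par big1 // => e _; rewrite inE. Qed.

Lemma par1 e U : par [set e] U = crossing U (ends e).
Proof.
rewrite /par (bigD1 e) //= inE eqxx big1 ?addbF // => f /negPf fe.
by rewrite inE fe.
Qed.

(* The edge set P has odd degree exactly at a and b (nowhere if a = b): it is
   an a-b path plus an even edge set. *)
Definition joins P a b := [forall U : {set N}, par P U == (a \in U) (+) (b \in U)].

Lemma joins_parP P a b : reflect (forall U, par P U = (a \in U) (+) (b \in U)) (joins P a b).
Proof. by apply: (iffP forallP) => H U; [apply/eqP | apply/eqP/H]. Qed.

Lemma joins_symd P Q a b c : joins P a b -> joins Q b c -> joins (symd P Q) a c.
Proof.
move=> /joins_parP HP /joins_parP HQ; apply/joins_parP => U; rewrite par_symd HP HQ.
by case: (a \in U); case: (b \in U); case: (c \in U).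
Qed.

Lemma joins_sym P a b : joins P a b = joins P b a.
Proof. by apply: eq_forallb => U; rewrite addbC. Qed.

Lemma joins0 a : joins set0 a a.
Proof. by apply/joins_parP => U; rewrite par0 addbb. Qed.

Lemma joins1 e : joins [set e] (ends e).1 (ends e).2.
Proof. by apply/joins_parP => U; rewrite par1 crossingE. Qed.

Definition step (S : {set E}) : rel N := fun x y =>
  [exists e in S, (ends e == (x, y)) || (ends e == (y, x))].

Lemma step_sym S : symmetric (step S).
Proof. by move=> x y; apply: eq_existsb => e; rewrite orbC. Qed.

Lemma step_joins S x y : step S x y -> exists2 e, e \in S & joins [set e] x y.
Proof.
case/existsP => e /andP[eS /orP[/eqP he|/eqP he]]; exists e => //;
  by have := joins1 e; rewrite he // joins_sym.
Qed.

Lemma connect_joins S a b : connect (step S) a b ->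
  exists2 P : {set E}, P \subset S & joins P a b.
Proof.
case/connectP => p; elim: p a => [|x p IHp] a /=.
  by move=> _ ->; exists set0; rewrite ?sub0set // joins0.
case/andP => /step_joins [e eS Je] /IHp{}IHp /IHp [P PS JP].
exists (symd [set e] P); last exact: joins_symd Je JP.
apply/subsetP => f; rewrite in_symd inE.
by case: eqP => [->//|_] /=; apply: (subsetP PS).
Qed.


Lemma connect_step_closed (S : {set E}) x e :
  e \in S -> connect (step S) x (ends e).1 = connect (step S) x (ends e).2.
Proof.
move=> eS.
have st : step S (ends e).1 (ends e).2.
  by apply/existsP; exists e; rewrite eS -surjective_pairing eqxx.
apply/idP/idP => h; apply: (connect_trans h); apply: connect1 => //.
by rewrite step_sym.
Qed.

(** No edge of [P] leaves the component of [a] in [P], so its parity is even; containing [a], it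
    must contain [b]. *)
Lemma joins_connect P a b : joins P a b -> connect (step P) a b.
Proof.
move=> /joins_parP /(_ [set y | connect (step P) a y]).
rewrite !inE connect0 /par big1; last first.
  move=> e _; case: (boolP (e \in P)) => //= eP.
  by rewrite crossingE !inE (connect_step_closed _ eP) addbb.
by case: (connect _ _ _).
Qed.

(* [f |: P0] is the portion, up to its first arrival in K, of an a-b path in P. *)
Lemma joins_first_arrival P (K : {set N}) a b : joins P a b -> a \notin K -> b \in K ->
  exists f x (P0 : {set E}), [/\ f \in P, crossing K (ends f), x \in K,
    [/\ P0 \subset P, f \notin P0 &
        forall e, e \in P0 -> ((ends e).1 \notin K) && ((ends e).2 \notin K)] &
    joins (f |: P0) a x].
Proof.
move=> /joins_parP JP aK bK.
(* [A] is what [a] reaches in [P] without touching [K]. If no edge of [P] led from [A] into [K],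
   none would cross [A] at all, against the parity of [A], which contains [a] but not [b]. *)
pose S := [set e in P | ((ends e).1 \notin K) && ((ends e).2 \notin K)].
pose A := [set y | connect (step S) a y].
have AK y : y \in A -> y \notin K.
  rewrite inE => /connectP[p]; case/lastP: p => [_ ->//|p z].
  rewrite rcons_path last_rcons => /andP[_ st] ->.
  case/existsP: st => e /andP[]; rewrite inE => /and3P[_ e1 e2].
  by case/orP => /eqP he; move: e1 e2; rewrite he.
have [/existsP[f /andP[fP /existsP[z /andP[zA /existsP[x /andP[xK fzx]]]]]]|no] :=
  boolP [exists f in P, [exists z in A, [exists x in K,
    (ends f == (z, x)) || (ends f == (x, z))]]].
  have: connect (step S) a z by rewrite inE in zA.
  case/connect_joins => P0 P0S JP0.
  have fK : crossing K (ends f).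
    by rewrite crossingE; case/orP: fzx => /eqP -> /=; rewrite (negPf (AK _ zA)) xK.
  have fP0 : f \notin P0.
    apply/negP => /(subsetP P0S); rewrite inE => /and3P[_].
    by move: fK; rewrite crossingE; case: (_ \in K); case: (_ \in K).
  exists f, x, P0; split => //; first split=> //.
  - by apply/subsetP => e /(subsetP P0S); rewrite inE => /andP[].
  - by move=> e /(subsetP P0S); rewrite inE => /and3P[_ -> ->].
  have -> : f |: P0 = symd P0 [set f].
    apply/setP => e; rewrite !inE; case: (eqVneq e f) => [->|]; rewrite ?(negPf fP0) ?addbF //.
  apply: (joins_symd JP0); have := joins1 f.
  by case/orP: fzx => /eqP -> //=; rewrite joins_sym.
have := JP A; rewrite [a \in A]inE connect0 (negPf (contraL (AK b) bK)) /par big1 // => e _.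
case: (boolP (e \in P)) => //= eP; apply/negbTE; rewrite crossingE.
have [eS|eS] := boolP (e \in S).
  by rewrite !inE (connect_step_closed _ eS) addbb.
apply: contra no => cr; apply/existsP; exists e; rewrite eP /=.
move: eS; rewrite !inE eP /= negb_and !negbK => eK.
case: (boolP ((ends e).1 \in A)) cr => [e1A|e1A] /= e2A.
  have e1K := AK _ e1A; move: eK; rewrite (negPf e1K) /= => e2K.
  apply/existsP; exists (ends e).1; rewrite e1A; apply/existsP; exists (ends e).2.
  by rewrite e2K -surjective_pairing eqxx.
have e2K := AK _ e2A; move: eK; rewrite (negPf e2K) orbF => e1K.
apply/existsP; exists (ends e).2; rewrite e2A; apply/existsP; exists (ends e).1.
by rewrite e1K -surjective_pairing eqxx orbT.
Qed.

End Parity.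

(** * Packing of T-cuts *)

Section TJoin.
Variables (R : realFieldType) (N E : finType) (ends : E -> N * N).
Implicit Types (P Q J : {set E}) (U K : {set N}) (w : E -> R).

Local Notation par := (par ends).
Local Notation joins := (joins ends).

Definition wt w P := \sum_(e in P) w e.

(** The change in the weight of [J] when the edges of [P] are toggled. *)
Definition signed_wt w J P := \sum_(e in P) (if e \in J then - w e else w e).

Lemma wt_symd w J P : wt w (symd J P) = wt w J + signed_wt w J P.
Proof.
rewrite /wt /signed_wt !(big_mkcond (fun e => e \in _)) -big_split.
apply: eq_bigr => e _; rewrite in_symd.
by case: (e \in J); case: (e \in P) => /=; rewrite ?subrr ?addr0 ?add0r.
Qed.

Lemma wt_symd0 w J P : (forall e, e \in P -> w e = 0) -> wt w (symd J P) = wt w J.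
Proof.
move=> P0; rewrite wt_symd /signed_wt big1 ?addr0 // => e /P0 ->.
by rewrite oppr0 if_same.
Qed.

Lemma wt_symd1 w J e : wt w (symd J [set e]) = wt w J + if e \in J then - w e else w e.
Proof. by rewrite wt_symd /signed_wt big_set1. Qed.

(* J and J' are T-joins for the same T. *)
Definition sim J : pred {set E} := fun J' => [forall U : {set N}, par J' U == par J U].

Lemma simP J J' : reflect (forall U, par J' U = par J U) (sim J J').
Proof. by apply: (iffP forallP) => H U; [apply/eqP | apply/eqP/H]. Qed.

Lemma joins_sim J J' P a b : sim J J' -> joins (symd J' P) a b = joins (symd J P) a b.
Proof. by move=> /simP s; apply: eq_forallb => U; rewrite !par_symd s. Qed.

Lemma zero_path w a b : connect (step ends [set e | w e == 0]) a b ->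
  exists2 Z : {set E}, (forall e, e \in Z -> w e = 0) & joins Z a b.
Proof.
case/connect_joins => Z sZ JZ; exists Z => // e /(subsetP sZ).
by rewrite inE => /eqP.
Qed.

(* K is the zero-weight component of an endpoint b of a pair {a, b} whose
   toggling in the parity class of J gives the cheapest joins. *)
Lemma critical_star w J : (forall e, 0 <= w e) ->
  (forall J', sim J J' -> wt w J <= wt w J') -> 0 < wt w J ->
  exists K : {set N}, (forall e, crossing K (ends e) -> 0 < w e) /\
    forall J', sim J J' -> wt w J' = wt w J ->
      #|[set e in J' | crossing K (ends e)]| = 1%N.
Proof.
move=> w0 minJ J0.
have [e eJ we] : exists2 e, e \in J & 0 < w e.
  apply/exists_inP; apply: contraTT J0; rewrite negb_exists_in => /forall_inP H.
  rewrite -leNgt /wt big1 // => e /H; rewrite -leNgt => we.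
  by apply/eqP; rewrite eq_le we w0.
(* A triple records two vertices and a set differing from [J] by a join of them; [t0] drops the
   positive edge [e] from [J]. *)
pose ok (t : N * N * {set E}) := joins (symd J t.2) t.1.1 t.1.2.
pose t0 := ((ends e), symd J [set e]).
have okt0 : ok t0 by rewrite /ok /t0 /= symdKl joins1.
case: (@arg_minP _ _ _ t0 ok (fun t => wt w t.2) okt0) => -[[a b] Js] /= okJ minm.
have mJ : wt w Js < wt w J.
  apply: le_lt_trans (minm _ okt0) _; rewrite /t0 /= wt_symd1 eJ; lra.
set m := wt w Js in minm mJ.
pose K := [set y | connect (step ends [set e | w e == 0]) b y].
have wK f : crossing K (ends f) -> 0 < w f.
  move=> fK; rewrite lt_neqAle w0 andbT eq_sym; apply: contraL fK => f0.
  have fz : f \in [set e | w e == 0] by rewrite inE.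
  by rewrite crossingE !inE (connect_step_closed ends b fz) addbb.
have low J' P x z : sim J J' -> joins P x z -> m <= wt w (symd J' P).
  move=> sJ jP; apply: (minm (x, z, symd J' P)).
  by rewrite /ok /= -(joins_sim _ _ _ sJ) symdKl.
have conK x y : x \in K -> y \in K ->
    exists2 Z : {set E}, (forall e, e \in Z -> w e = 0) & joins Z x y.
  rewrite !inE => hx hy; apply: zero_path; apply: connect_trans _ hy.
  by rewrite (sym_connect_sym (@step_sym _ _ _ _)).
have bK : b \in K by rewrite inE.
(* An edge [f] of the toggled set crossing [K] could be removed after a zero-weight detour inside
   [K], leaving a set of weight below the minimum [m]. *)
have star J' P x : sim J J' -> joins P a x -> x \in K -> wt w (symd J' P) <= m ->
    forall f, crossing K (ends f) -> (f \in P) = (f \in J').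
  move=> sJ jP xK le_m f fK.
  suff : f \notin symd J' P by rewrite in_symd; case: (f \in P); case: (f \in J').
  apply/negP => fJP.
  have [x' [z [x'K jf]]] : exists x' z, x' \in K /\ joins [set f] x' z.
    have jf := joins1 ends f; move: fK; rewrite crossingE.
    case: (boolP (_ \in K)) => h1 h2; first by exists (ends f).1, (ends f).2.
    by exists (ends f).2, (ends f).1; rewrite joins_sym.
  have [Z Z0 jZ] := conK _ _ xK x'K.
  have := low J' (symd (symd P Z) [set f]) a z sJ.
  move=> /(_ (joins_symd (joins_symd jP jZ) jf)).
  rewrite symdA wt_symd1 (symdA J') wt_symd0 // in_symd.
  have -> : f \in Z = false by apply/negP => /Z0; move: (wK _ fK) => /[swap] ->; rewrite ltxx.
  rewrite addbF fJP; move: (wK _ fK) => wf; lra.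
have aK : a \notin K.
  apply/negP => aK; have [Z Z0 jZ] := conK _ _ bK aK.
  have : wt w J <= wt w (symd Js Z).
    apply: minJ; apply/simP => U.
    have /joins_parP/(_ U) := joins_symd okJ jZ; rewrite /= !par_symd addbb.
    by case: (par J U); case: (par Js U); case: (par Z U).
  by rewrite wt_symd0 // => /(lt_le_trans mJ); rewrite ltxx.
exists K; split=> // J' sJ wJ'.
pose P := symd J' Js.
have jP : joins P a b by rewrite /P (joins_sim _ _ _ sJ).
have [f [x [P0 [fP fK xK [P0P fP0 P0K] jP1]]]] := joins_first_arrival jP aK bK.
set P1 := f |: P0 in jP1.
have P1P : P1 \subset P by rewrite subUset sub1set fP.
have [Z Z0 jZ] := conK _ _ bK xK.
(* The rest of [P] beyond [P1] is closed up by the free set [Z], so toggling it cannot lower the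
   weight of [J']. Hence toggling [P1] saves at least as much as toggling [P]. *)
have le1 : wt w (symd J' P1) <= m.
  have : wt w J <= wt w (symd (symd J' (symd P P1)) Z).
    apply: minJ; apply/simP => U; rewrite !par_symd.
    have /joins_parP/(_ U) := joins_symd jP jZ; rewrite par_symd.
    have /joins_parP/(_ U) -> := jP1; rewrite (simP _ _ sJ) => <-.
    by rewrite /P par_symd (simP _ _ sJ); case: (par J U); case: (par Js U); case: (par Z U).
  rewrite wt_symd0 // wt_symd wJ' symd_sub //.
  have : wt w (symd J' P) = m by rewrite /P symdKl.
  rewrite !wt_symd wJ' {1}/signed_wt (big_setID P1) /= (setIidPr P1P).
  rewrite -/(signed_wt _ _ _) -/(signed_wt _ _ (P :\: P1)); lra.
have Kst := star J' P1 x sJ jP1 xK le1.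
rewrite (_ : [set _ in _ | _] = [set f]) ?cards1 //.
apply/setP => g; rewrite !inE; apply/andP/eqP => [[gJ gK]|->]; last first.
  by rewrite -Kst // !inE eqxx.
move: gJ; rewrite -Kst // !inE => /orP[/eqP//|/P0K].
by move: gK; rewrite crossingE; case: (_ \in K); case: (_ \in K).
Qed.


Lemma wt_sub_star w K J (eps : R) :
  wt (fun e => if crossing K (ends e) then w e - eps else w e) J =
  wt w J - eps *+ #|[set e in J | crossing K (ends e)]|.
Proof.
rewrite /wt -sumr_const (eq_bigl (fun e => (e \in J) && crossing K (ends e)) (fun=> eps)).
  by rewrite [in RHS]big_mkcondr -sumrB; apply: eq_bigr => e _; case: ifP; rewrite ?subr0.
by move=> e; rewrite inE.
Qed.

(** The T-cut packing theorem of Edmonds and Johnson. The weights on the cut of a critical star [K]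
    are lowered as far as nonnegativity and minimality of [J] allow, and [K] receives that amount in
    the packing. The induction counts the positive edges and the members of the class heavier than
    [J]. *)
Lemma tjoin_packing w J : (forall e, 0 <= w e) ->
  (forall J', sim J J' -> wt w J <= wt w J') ->
  exists y : {set N} -> R,
    [/\ forall U, 0 <= y U, forall U, y U != 0 -> par J U,
        forall e, \sum_(U | crossing U (ends e)) y U <= w e &
        \sum_U y U = wt w J].
Proof.
pose msr w := (#|[set e | (0 < w e)%R]| +
               #|[set J' | sim J J' && (wt w J < wt w J')%R]|)%N.
have [n] := ubnP (msr w); elim: n w => // n IHn w; rewrite ltnS => le_n w0 minJ.
have [J0|] := ltP 0 (wt w J); last first.
  move=> J0; exists (fun=> 0); split=> // [U||]; rewrite ?eqxx //.
    by move=> e; rewrite big1.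
  rewrite big1 //; apply/esym/eqP; rewrite eq_le J0 sumr_ge0 // => e _; exact: w0.
have [K [wK starK]] := critical_star w0 minJ J0.
pose c J' := #|[set e in J' | crossing K (ends e)]|.
have simJ : sim J J by apply/simP.
have oddc J' : sim J J' -> odd (c J').
  by move/simP => sJ; rewrite /c -par_card sJ par_card starK.
have c1 J' : sim J J' -> c J' != 1%N -> (1 < c J')%N /\ wt w J < wt w J'.
  move=> sJ c1; split; first by case: (c J') c1 (oddc _ sJ) => [|[]].
  rewrite lt_neqAle minJ // andbT; apply: contra c1 => /eqP wJ.
  by rewrite /c starK.
(* Lowering the cut by [eps] lowers [J] once and [J'] exactly [c J'] times, so the slack of [J']
   shrinks at rate [(c J').-1]. The amount [eps] is the least of these ratios and of the weights on
   the cut. *)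
pose cand (t : E + {set E}) := match t with
  | inl e => crossing K (ends e) | inr J' => sim J J' && (c J' != 1%N) end.
pose val (t : E + {set E}) := match t with
  | inl e => w e | inr J' => (wt w J' - wt w J) / (c J').-1%:R end.
have [f fK] : exists f, crossing K (ends f).
  have /eqP := starK _ simJ erefl; case/cards1P => f /setP/(_ f).
  by rewrite !inE eqxx => /andP[_ fK]; exists f.
case: (@arg_minP _ _ _ (inl f : E + {set E}) cand val fK) => t0 t0c t0min.
set eps := val t0 in t0min.
have valJ J' : sim J J' -> c J' != 1%N -> eps *+ (c J').-1 <= wt w J' - wt w J.
  move=> sJ cJ; have [c2 _] := c1 _ sJ cJ.
  have := t0min (inr J'); rewrite /= sJ cJ => /(_ isT).
  by rewrite ler_pdivlMr ?mulr_natr // ltr0n; case: (c J') c2 => [|[]].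
have eps0 : 0 < eps.
  rewrite /eps; case: t0 t0c {t0min valJ eps} => [e /wK //|J' /= /andP[sJ cJ]].
  have [c2 wlt] := c1 _ sJ cJ; rewrite divr_gt0 ?subr_gt0 // ltr0n.
  by case: (c J') c2 => [|[]].
pose w' e := if crossing K (ends e) then w e - eps else w e.
have w'J J' : wt w' J' = wt w J' - eps *+ c J' by exact: wt_sub_star.
have cJ : c J = 1%N by rewrite /c starK.
have w'0 e : 0 <= w' e.
  rewrite /w'; case: ifP => // eK; rewrite subr_ge0.
  by apply: (t0min (inl e)).
have minJ' J' : sim J J' -> wt w' J <= wt w' J'.
  move=> sJ; rewrite !w'J cJ; have [cJ'|cJ'] := eqVneq (c J') 1%N.
    by rewrite cJ' lerD2r minJ.
  have [c2 _] := c1 _ sJ cJ'; have := valJ _ sJ cJ'.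
  by case: (c J') c2 => [//|k] _ /=; rewrite mulrS; lra.
have leE : [set e | 0 < w' e] \subset [set e | 0 < w e].
  apply/subsetP => e; rewrite !inE /w'; case: ifP => // _; lra.
have leS : [set J' | sim J J' && (wt w' J < wt w' J')] \subset
           [set J' | sim J J' && (wt w J < wt w J')].
  apply/subsetP => J'; rewrite !inE => /andP[sJ]; rewrite sJ /= !w'J cJ.
  have [cJ'|/(c1 _ sJ)[]//] := eqVneq (c J') 1%N; rewrite cJ'; lra.
have lt_n : (msr w' < n)%N.
  apply: leq_trans le_n; rewrite /msr.
  (* If an edge attains [eps], it stops being positive; if some [J'] does, it becomes minimum and is
     no longer heavier than [J]. *)
  case: t0 @eps t0c {t0min valJ} eps0 @w' w'J w'0 minJ' leE leS => [e|J'] /=.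
    move=> eK eps0 w'J w'0 minJ' leE leS; rewrite -addSn leq_add ?subset_leq_card //.
    apply/proper_card/properP; split=> //; exists e; rewrite !inE ?eK //.
    by rewrite subrr ltxx.
  set eps := _ / _; move=> /andP[sJ cJ'] eps0 w'J w'0 minJ' leE leS.
  have [c2 wlt] := c1 _ sJ cJ'.
  rewrite -addnS leq_add ?subset_leq_card //.
  apply/proper_card/properP; split=> //; exists J'; rewrite !inE sJ //= !w'J cJ.
  rewrite -leNgt; have : eps *+ (c J').-1 = wt w J' - wt w J.
    rewrite -mulr_natr divfK // pnatr_eq0.
    by case: (c J') c2 => [|[]].
  by case: (c J') c2 => [//|k] _ /= ek; rewrite mulrS ek; lra.
have [y [y0 yodd yw ysum]] := IHn w' lt_n w'0 minJ'.
exists (fun U => y U + if U == K then eps else 0); split.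
- by move=> U; rewrite addr_ge0 //; case: ifP => // _; exact: ltW.
- move=> U; case: (eqVneq U K) => [-> _|_]; last by rewrite addr0; exact: yodd.
  by rewrite par_card oddc.
- move=> e; rewrite big_split /= -big_mkcondr /=.
  have := yw e; rewrite /w'; case: ifP => eK le_yw; last first.
    rewrite [X in _ + X]big1 ?addr0 // => U /andP[/[swap] /eqP ->].
    by rewrite eK.
  rewrite [X in _ + X](big_pred1 K) -?lerBrDr // => U /=.
  by case: (eqVneq U K) => [->|]; rewrite ?eK ?andbF.
rewrite big_split /= ysum w'J cJ -big_mkcond big_pred1_eq mulr1n; lra.
Qed.

End TJoin.

(** * Noncrossing covers of demands on a line *)

Section Valley.
Variable R : realFieldType.
Implicit Types (f : nat -> R) (g z : nat) (x : R).

Definition valley f g g' := \big[Num.min/f g]_(g <= z < g'.+1) f z.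

(* Distance between g and g' in the tree with contour f. *)
Definition tdist f g g' := f g + f g' - 2 * valley f g g'.

Lemma bigmin_nat_le x f m n z : (m <= z < n)%N ->
  \big[Num.min/x]_(m <= i < n) f i <= f z.
Proof. by move=> mzn; apply: ge_bigmin_seq; rewrite ?mem_index_iota. Qed.

Lemma bigmin_nat_attained x f m n :
  \big[Num.min/x]_(m <= i < n) f i = x \/
  exists2 z, (m <= z < n)%N & \big[Num.min/x]_(m <= i < n) f i = f z.
Proof.
rewrite big_seq_cond.
elim/big_ind: _ => [|u v|z]; first by left.
  by rewrite /Num.min; case: ifP.
by rewrite mem_index_iota andbT => mzn; right; exists z.
Qed.

Lemma valley_le f g g' z : (g <= z <= g')%N -> valley f g g' <= f z.
Proof. by move=> h; apply: bigmin_nat_le; rewrite ltnS. Qed.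

Lemma valley_attained f g g' : (g <= g')%N ->
  exists2 z, (g <= z <= g')%N & valley f g g' = f z.
Proof.
move=> gg'; rewrite /valley; have [->|[z]] := bigmin_nat_attained (f g) f g g'.+1.
  by exists g; rewrite ?leqnn.
by rewrite ltnS => zg ->; exists z.
Qed.

Lemma tdist_ge f g g' z : (g <= z <= g')%N -> f g + f g' - 2 * f z <= tdist f g g'.
Proof. by move=> /(valley_le f); rewrite /tdist; lra. Qed.

Lemma tdist_le f g g' x : (g <= g')%N ->
  (forall z, (g <= z <= g')%N -> f g + f g' - 2 * f z <= x) -> tdist f g g' <= x.
Proof. by move=> /(valley_attained f)[z hz ez] /(_ z hz); rewrite /tdist ez. Qed.

Lemma tdist_norm_le f g g' : (g <= g')%N -> `|f g - f g'| <= tdist f g g'.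
Proof.
move=> gg'; have h1 := @tdist_ge f g g' g; have h2 := @tdist_ge f g g' g'.
move: h1 h2; rewrite !leqnn gg' /= => /(_ isT) h1 /(_ isT) h2.
rewrite ler_norml; apply/andP; split; lra.
Qed.

Lemma eq_tdist f f' g g' : (g <= g')%N ->
  (forall z, (g <= z <= g')%N -> f z = f' z) -> tdist f g g' = tdist f' g g'.
Proof.
move=> gg' eqf; rewrite /tdist /valley !eqf ?leqnn ?gg' //.
by congr (_ - 2 * _); apply: eq_big_nat => z; rewrite ltnS => /eqf.
Qed.

End Valley.

Section Chords.
Variables (R : realFieldType) (I : finType) (lo hi : I -> nat) (r : I -> R).
Hypothesis r0 : forall h, 0 <= r h.
Implicit Types (P Q : pred I) (f : nat -> R) (g z a b m : nat).

Definition inside h g := (lo h < g <= hi h)%N.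

(* Corners lie between consecutive gaps (corner i between gaps i and i+1), so
   the chord from corner lo h to corner hi h cuts off the gaps inside h. *)
Definition delta P g g' := \sum_(h | P h) r h *+ (inside h g (+) inside h g').

Lemma delta_ge0 P g g' : 0 <= delta P g g'.
Proof. by apply: sumr_ge0 => h _; rewrite mulrn_wge0. Qed.

Lemma delta_sym P g g' : delta P g g' = delta P g' g.
Proof. by apply: eq_bigr => h _; rewrite addbC. Qed.

Lemma delta_tri P g g' g'' : delta P g g'' <= delta P g g' + delta P g' g''.
Proof.
rewrite -big_split; apply: ler_sum => h _; have := r0 h.
by case: (inside h g); case: (inside h g'); case: (inside h g'') => /=; lra.
Qed.

(* On a cyclic sequence of gaps, chords can be drawn without crossings so that
   the chords separating gaps g and g' have total weight [tdist f g g'];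
   [dominated] says that this is at most the demand separated, [delta P g g']. *)
Definition dominated P f :=
  forall g z g', (g <= z <= g')%N -> f g + f g' - 2 * f z <= delta P g g'.

(** Vanishing outside the open block lets contours of adjacent blocks be added without interference:
    both are 0 at the common boundary gap. *)
Definition contour a b P f :=
  [/\ forall g, 0 <= f g, forall g, ~~ (a < g < b)%N -> f g = 0 & dominated P f].

Lemma contour0 a b P : contour a b P (fun=> 0).
Proof. by split=> // g z g' _; rewrite mulr0 addr0 subr0 delta_ge0. Qed.

Lemma contour_add a1 b1 a2 b2 a b P1 P2 P f1 f2 :
  contour a1 b1 P1 f1 -> contour a2 b2 P2 f2 ->
  (a <= a1)%N -> (a <= a2)%N -> (b1 <= b)%N -> (b2 <= b)%N ->
  (forall g g', delta P1 g g' + delta P2 g g' <= delta P g g') ->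
  contour a b P (fun g => f1 g + f2 g).
Proof.
move=> [p1 s1 d1] [p2 s2 d2] aa1 aa2 bb1 bb2 le_d; split.
- by move=> g; rewrite addr_ge0.
- by move=> g hg; rewrite s1 ?s2 ?addr0 //; apply: contra hg; lia.
move=> g z g' h; apply: le_trans (le_d g g').
by have := d1 _ _ _ h; have := d2 _ _ _ h; lra.
Qed.

Lemma contour_sub a1 b1 a b P1 P f :
  contour a1 b1 P1 f -> (a <= a1)%N -> (b1 <= b)%N ->
  (forall g g', delta P1 g g' <= delta P g g') -> contour a b P f.
Proof.
move=> [p1 s1 d1] aa1 bb1 le_d; split=> // [g hg|g z g' h].
  by apply: s1; apply: contra hg; lia.
exact: le_trans (d1 _ _ _ h) (le_d g g').
Qed.

Section Split.
Variables (a b m : nat) (P : pred I).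
Hypotheses (am : (a <= m)%N) (mb : (m <= b)%N).
Hypothesis PX : forall h, P h -> [&& (a <= lo h)%N, (lo h < m)%N, (m <= hi h)%N & (hi h < b)%N].

(** All chords of [P] pass over [m], so this height never decreases up to [m] and never increases
    afterwards: it is the contour of a nested matching. *)
Definition ridge g := \sum_(h | P h) r h *+ inside h g.

Lemma ridge_ge0 g : 0 <= ridge g.
Proof. by apply: sumr_ge0 => h _; rewrite mulrn_wge0. Qed.

Lemma ridge_out g : ~~ (a < g < b)%N -> ridge g = 0.
Proof.
move=> hg; apply: big1 => h /PX; rewrite /inside => hX.
by rewrite (_ : (_ < _ <= _)%N = false) //; apply/negbTE; apply: contra hg; lia.
Qed.

Lemma delta_out g g' : ~~ (a < g' < b)%N -> delta P g g' = ridge g.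
Proof.
move=> hg; apply: eq_bigr => h /PX; rewrite /inside => hX; congr (_ *+ nat_of_bool _).
by rewrite [X in _ (+) X](_ : _ = false) ?addbF //; apply/negbTE; apply: contra hg; lia.
Qed.

Lemma deltaL g g' : (g <= g' <= m)%N -> delta P g g' = ridge g' - ridge g.
Proof.
move=> hg; rewrite /delta /ridge -sumrB; apply: eq_bigr => h /PX hX.
have -> : inside h g = (lo h < g)%N by rewrite /inside; lia.
have -> : inside h g' = (lo h < g')%N by rewrite /inside; lia.
have [h1|h1] := ltnP (lo h) g; last by rewrite /= subr0.
by rewrite (leq_trans h1) //= ?subrr //; lia.
Qed.

Lemma deltaR g g' : (m <= g <= g')%N -> delta P g g' = ridge g - ridge g'.
Proof.
move=> hg; rewrite /delta /ridge -sumrB; apply: eq_bigr => h /PX hX.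
have -> : inside h g = (g <= hi h)%N by rewrite /inside; lia.
have -> : inside h g' = (g' <= hi h)%N by rewrite /inside; lia.
have [h1|h1] := leqP g' (hi h); last by rewrite /= subr0 addbF.
by rewrite (_ : (g <= hi h)%N) //= ?subrr //; lia.
Qed.

Lemma ridge_dist g g' : `|ridge g - ridge g'| <= delta P g g'.
Proof.
rewrite -sumrB; apply: le_trans (ler_norm_sum _ _ _) _; apply: ler_sum => h _.
have := r0 h; case: (inside h g); case: (inside h g') => //= rh;
  by rewrite ?subrr ?subr0 ?sub0r ?normrN ?normr0 ?ger0_norm // mulr1n.
Qed.

Lemma ridge_contour : contour a b P ridge.
Proof.
split; [exact: ridge_ge0 | exact: ridge_out |] => g z g' hz.
have := ridge_dist g g'; rewrite ler_norml => /andP[h2 h3].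
have [zm|mz] := leqP z m.
  have := delta_ge0 P g z; rewrite deltaL; [lra | lia].
have := delta_ge0 P z g'; rewrite deltaR; [lra | lia].
Qed.

Section Moat.
Variables (p q c d : nat).
Hypothesis cd : (c <= d)%N.
Hypothesis delta_add : forall g z g', (p <= g)%N -> (g <= z <= g')%N -> (g' <= q)%N ->
  delta P g g' = delta P g z + delta P z g'.
Hypothesis escape : forall g, ~~ (p < g < q)%N ->
  exists2 z, (c <= z <= d)%N & delta P g z = 0.

(** The [delta]-distance from the gap [g] to the range from [c] to [d], which will be the sibling of
    the block. By [escape] this distance vanishes outside the block, in agreement with the last
    branch. *)
Definition moat g :=
  if (p < g < q)%N then \big[Num.min/delta P g c]_(c <= z < d.+1) delta P g z else 0.

Lemma moat_attained g : exists2 z, (c <= z <= d)%N & moat g = delta P g z.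
Proof.
rewrite /moat; case: ifPn => [_|/escape[z zcd ez]]; last by exists z; rewrite ?ez.
have [->|[z]] := bigmin_nat_attained (delta P g c) (delta P g) c d.+1.
  by exists c; rewrite ?leqnn.
by rewrite ltnS => zcd ->; exists z.
Qed.

Lemma moat_ge0 g : 0 <= moat g.
Proof. by have [z _ ->] := moat_attained g; exact: delta_ge0. Qed.

Lemma moat_le g z : (c <= z <= d)%N -> moat g <= delta P g z.
Proof.
move=> zcd; rewrite /moat; case: ifP => _; last exact: delta_ge0.
exact: bigmin_nat_le.
Qed.

Lemma moat_lip g g' : moat g - moat g' <= delta P g g'.
Proof.
have [z zcd ->] := moat_attained g'; have := moat_le g zcd.
have := delta_tri P g g' z; lra.
Qed.

(** A distance to a set is 1-Lipschitz, and [delta] is additive inside the block, so the Lipschitz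
    bounds from [g] and from [g'] to [z] add up to [delta P g g']. *)
Lemma moat_contour : contour p q P moat.
Proof.
split; [exact: moat_ge0 | by move=> g /negPf hg; rewrite /moat hg |] => g z g' hz.
have z0 := moat_ge0 z.
have out x y : ~~ (p < y < q)%N -> moat x + moat y <= delta P x y.
  move=> hy; rewrite [moat y](_ : _ = 0) ?addr0; last by rewrite /moat (negPf hy).
  have := moat_lip x y; rewrite [moat y](_ : _ = 0) ?subr0 //.
  by rewrite /moat (negPf hy).
have [hg|/(out g')] := boolP (p < g < q)%N; last first.
  by rewrite delta_sym; lra.
have [hg'|/(out g)] := boolP (p < g' < q)%N; last by lra.
rewrite (delta_add (z := z)) //; [|lia|lia].
have := moat_lip g z; have := moat_lip g' z; rewrite (delta_sym _ g' z); lra.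
Qed.

End Moat.

Definition moatL := moat a m m b.
Definition moatR := moat m b a m.

Lemma delta_eq0_out g g' : ~~ (a < g < b)%N -> ~~ (a < g' < b)%N -> delta P g g' = 0.
Proof. by move=> hg hg'; rewrite delta_out ?ridge_out. Qed.

Lemma delta_diag g : delta P g g = 0.
Proof. by apply: big1 => h _; rewrite addbb. Qed.

Lemma escapeL g : ~~ (a < g < m)%N -> exists2 z, (m <= z <= b)%N & delta P g z = 0.
Proof.
move=> hg; have [gb|bg] := leqP g b.
  have [ga|ag] := leqP g a.
    by exists b; rewrite ?mb ?leqnn // delta_eq0_out // ?ltnn ?andbF //; lia.
  by exists g; rewrite ?delta_diag //; lia.
by exists b; rewrite ?mb ?leqnn // delta_eq0_out // ?ltnn ?andbF //; lia.
Qed.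

Lemma escapeR g : ~~ (m < g < b)%N -> exists2 z, (a <= z <= m)%N & delta P g z = 0.
Proof.
move=> hg; have [ag|ga] := leqP a g; last first.
  by exists a; rewrite ?am ?leqnn // delta_eq0_out // ?ltnn //; lia.
have [bg|gb] := leqP b g.
  by exists a; rewrite ?am ?leqnn // delta_eq0_out // ?ltnn //; lia.
by exists g; rewrite ?delta_diag //; lia.
Qed.

Lemma moatL_contour : contour a m P moatL.
Proof.
apply: moat_contour mb _ escapeL => g z g' ag hz gm.
by rewrite !deltaL; [lra|lia..].
Qed.

Lemma moatR_contour : contour m b P moatR.
Proof.
apply: moat_contour am _ escapeR => g z g' ag hz gm.
by rewrite !deltaR; [lra|lia..].
Qed.

(** Passing through the gap of the right half nearest to [g] bounds the left side by the height
    difference plus twice [moatL g]; symmetrically the bound holds with twice [moatR g']. The claim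
    is the average of the two. *)
Lemma delta_cross g g' : (g <= m <= g')%N ->
  delta P g g' <= `|ridge g - ridge g'| + moatL g + moatR g'.
Proof.
case/andP => gm mg'.
have [z1 z1m e1] := moat_attained mb escapeL g.
have [z2 z2m e2] := moat_attained am escapeR g'.
rewrite -/moatL in e1; rewrite -/moatR in e2; rewrite e1 e2.
have d1 : delta P z1 g' = `|ridge z1 - ridge g'|.
  have [le|lt] := leqP z1 g'.
    by rewrite -deltaR ?ger0_norm ?delta_ge0 //; lia.
  by rewrite distrC delta_sym -deltaR ?ger0_norm ?delta_ge0 //; lia.
have d2 : delta P z2 g = `|ridge z2 - ridge g|.
  have [le|lt] := leqP z2 g.
    by rewrite distrC -deltaL ?ger0_norm ?delta_ge0 //; lia.
  by rewrite delta_sym -deltaL ?ger0_norm ?delta_ge0 //; lia.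
have := delta_tri P g z1 g'; have := delta_tri P g' z2 g; rewrite d1 d2.
rewrite (delta_sym _ g' g).
have := ridge_dist g z1; have := ridge_dist g' z2.
have := ler_distD (ridge g) (ridge z1) (ridge g').
have := ler_distD (ridge g') (ridge z2) (ridge g).
rewrite (distrC (ridge z1) (ridge g)) (distrC (ridge z2) (ridge g')).
rewrite (distrC (ridge g') (ridge g)); lra.
Qed.

Lemma tdist_ridge g g' : (g <= g')%N ->
  ((g' <= m) || (m <= g))%N -> delta P g g' <= tdist ridge g g'.
Proof.
move=> gg' /orP[h|h].
  rewrite deltaL ?gg' //; apply: le_trans (tdist_ge ridge (z := g) _); rewrite ?leqnn //; lra.
rewrite deltaR ?h //; apply: le_trans (tdist_ge ridge (z := g') _); rewrite ?leqnn ?gg' //; lra.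
Qed.

End Split.

Lemma sum_marked_gt0 (mk : pred nat) a b i : (a <= i < b)%N -> mk i ->
  (0 < \sum_(a <= j < b) mk j)%N.
Proof.
move=> iab mki; rewrite (bigD1_seq i) ?mem_index_iota ?iota_uniq //=.
by rewrite mki.
Qed.

Lemma split_marked (mk : pred nat) a b x y : (a <= b)%N ->
  (\sum_(a <= j < b) mk j <= x + y)%N ->
  exists m, [/\ (a <= m <= b)%N, (\sum_(a <= j < m) mk j <= x)%N &
                (\sum_(m <= j < b) mk j <= y)%N].
Proof.
move=> ab le_xy.
pose ok m := (a <= m <= b)%N && (\sum_(a <= j < m) mk j <= x)%N.
have ex : exists m, ok m by exists a; rewrite /ok leqnn ab big_geq.
have ub m : ok m -> (m <= b)%N by case/andP => /andP[].
case: (ex_maxnP ex ub) => m /andP[amb le_x] maxm; exists m; split=> //.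
case/andP: amb => am; rewrite leq_eqVlt => /orP[/eqP ->|mb]; first by rewrite big_geq.
have : ~~ ok m.+1 by apply/negP => /maxm; rewrite ltnn.
rewrite /ok (leqW am) mb /= -ltnNge big_nat_recr //= => lt_x.
move: le_xy; rewrite (@big_cat_nat _ _ _ m) //=; last exact: ltnW.
by case: (mk m) lt_x => /=; lia.
Qed.

Lemma delta_split P m g g' : (forall h, P h -> (lo h <= hi h)%N) ->
  delta P g g' = delta (fun h => P h && (hi h < m)%N) g g' +
    delta (fun h => P h && (m <= lo h)%N) g g' +
    delta (fun h => P h && (lo h < m <= hi h)%N) g g'.
Proof.
move=> lohi; rewrite /delta [LHS]big_mkcond.
rewrite [X in X + _ + _]big_mkcond [X in _ + X + _]big_mkcond [X in _ + _ + X]big_mkcond.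
rewrite -!big_split; apply: eq_bigr => h _ /=.
case: (boolP (P h)) => [/lohi lh|_] /=; last by rewrite !addr0.
have [h1|h1] := ltnP (hi h) m.
  have -> : (m <= lo h)%N = false by lia.
  by rewrite andbF !addr0.
by rewrite andbT; have [h2|h2] := leqP m (lo h); rewrite /= ?add0r ?addr0.
Qed.

(* Each dyadic level contributes one nested matching (its ridge), and the moats
   of all levels fit into one more slot than there are levels, because a block
   shares its slot only with the blocks inside its sibling. *)
Lemma contour_cover (mk : pred nat) L a b P : (a <= b)%N ->
  (\sum_(a <= j < b) mk j <= 2 ^ L)%N ->
  (forall h, P h -> [&& (a <= lo h)%N, (lo h <= hi h)%N, (hi h < b)%N, mk (lo h) & mk (hi h)]) ->
  exists M B : nat -> nat -> R,
    [/\ forall i, contour a b P (M i), forall i, contour a b P (B i) &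
      forall g g', (g <= g')%N -> delta P g g' <=
        \sum_(i < L) tdist (M i) g g' + \sum_(i < L.+1) tdist (B i) g g'].
Proof.
elim: L a b P => [|L IHL] a b P ab le_mk Pok.
  have d0 g g' : delta P g g' = 0.
    apply: big1 => h /Pok /and5P[alo lohi hib mklo mkhi].
    suff in0 x : inside h x = false by rewrite !in0.
    rewrite /inside; case: (ltngtP (lo h) (hi h)) lohi => // [lt _|->]; last lia.
    have := @sum_marked_gt0 mk a (hi h) (lo h); rewrite alo lt => /(_ isT mklo).
    have := @sum_marked_gt0 mk (hi h) b (hi h); rewrite leqnn hib => /(_ isT mkhi).
    move: le_mk; rewrite (@big_cat_nat _ _ _ (hi h)) /=; [lia | lia | exact: ltnW].
  exists (fun _ _ => 0), (fun _ _ => 0); split=> [i|i|g g' gg']; try exact: contour0.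
  rewrite d0 big_ord0 add0r big_ord1.
  by have [z _ e] := valley_attained (fun=> 0 : R) gg'; rewrite /tdist e; lra.
have lohi h : P h -> (lo h <= hi h)%N by case/Pok/and5P.
have := le_mk; rewrite expnS mul2n -addnn => /(split_marked ab)[m [/andP[am mb] mkl mkr]].
pose Pl h := P h && (hi h < m)%N; pose Pr h := P h && (m <= lo h)%N.
pose Px h := P h && (lo h < m <= hi h)%N.
have dP g g' : delta P g g' = delta Pl g g' + delta Pr g g' + delta Px g g'.
  exact: delta_split.
have [|M1 [B1 [cM1 cB1 cov1]]] := IHL a m Pl am mkl.
  by move=> h /andP[/Pok/and5P[-> -> _ -> ->] ->].
have [|M2 [B2 [cM2 cB2 cov2]]] := IHL m b Pr mb mkr.
  by move=> h /andP[/Pok/and5P[_ -> -> -> ->] ->].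
have PXx h : Px h -> [&& (a <= lo h)%N, (lo h < m)%N, (m <= hi h)%N & (hi h < b)%N].
  by move=> /andP[/Pok/and5P[-> _ -> _ _] /andP[-> ->]].
pose F := ridge Px; pose QL := moatL a b m Px; pose QR := moatR a b m Px.
have cF : contour a b Px F by exact: ridge_contour am mb PXx.
have cQL : contour a m Px QL by exact: moatL_contour am mb PXx.
have cQR : contour m b Px QR by exact: moatR_contour am mb PXx.
have dl0 g g' := delta_ge0 Pl g g'; have dr0 g g' := delta_ge0 Pr g g'.
have dx0 g g' := delta_ge0 Px g g'.
(* The ridge takes the new matching slot [L]. Among the moat slots the left half keeps its places
   and [QL] gets the last one, while the right half moves up by one and [QR] gets slot 0; so each
   new moat shares its slot only with a contour of the opposite half. *)
exists (fun i g => if (i < L)%N then M1 i g + M2 i g else F g).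
exists (fun i g => (if (i < L.+1)%N then B1 i g else QL g) +
                   (if (0 < i)%N then B2 i.-1 g else QR g)).
split=> [i|i|g g' gg'].
- case: (i < L)%N; last first.
    by apply: contour_sub cF _ _ _ => // x y; rewrite dP; move: (dl0 x y) (dr0 x y); lra.
  apply: (contour_add (cM1 i) (cM2 i)) => // x y.
  by rewrite dP; move: (dx0 x y); lra.
- have c1 : contour a m (if (i < L.+1)%N then Pl else Px)
      (fun g => if (i < L.+1)%N then B1 i g else QL g) by case: ifP.
  have c2 : contour m b (if (0 < i)%N then Pr else Px)
      (fun g => if (0 < i)%N then B2 i.-1 g else QR g) by case: ifP.
  apply: (contour_add c1 c2) => // x y.
  rewrite dP; move: (dx0 x y) (dl0 x y) (dr0 x y).
  by case: i {c1 c2} => [|i] /=; [|case: ifP => _]; lra.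
rewrite big_ord_recr /= ltnn.
rewrite (eq_bigr (fun i : 'I_L => tdist (fun g => M1 i g + M2 i g) g g')); last first.
  by move=> i _; rewrite ltn_ord.
have outl f Q x : contour a m Q f -> (m <= x)%N -> f x = 0.
  by case=> _ s0 _ h; apply: s0; lia.
have outr f Q x : contour m b Q f -> (x <= m)%N -> f x = 0.
  by case=> _ s0 _ h; apply: s0; lia.
have tge0 (f : nat -> R) x y : (x <= y)%N -> 0 <= tdist f x y.
  by move=> /(tdist_norm_le f); apply: le_trans.
have [g'm|mg'] := leqP g' m.
  have zm z : (g <= z <= g')%N -> (z <= m)%N by lia.
  rewrite big_ord_recr /= ltnn.
  rewrite (eq_bigr (fun i : 'I_L => tdist (M1 i) g g')); last first.
    move=> i _; apply: eq_tdist => // z hz.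
    by rewrite (outr _ _ _ (cM2 i)) ?addr0 // zm.
  rewrite [X in _ + (X + _)](eq_bigr (fun i : 'I_L.+1 => tdist (B1 i) g g')); last first.
    move=> i _; apply: eq_tdist => // z hz; rewrite ltn_ord.
    by case: ifP => _; rewrite ?(outr _ _ _ (cB2 _)) ?(outr _ _ _ cQR) ?addr0 // zm.
  rewrite (_ : tdist (fun g => QL g + B2 L g) g g' = tdist QL g g'); last first.
    by apply: eq_tdist => // z hz; rewrite (outr _ _ _ (cB2 L)) ?addr0 // zm.
  have := cov1 g g' gg'; have := tge0 QL _ _ gg'.
  have := tdist_ridge am mb PXx gg'; rewrite g'm => /(_ isT); rewrite -/F.
  rewrite dP; have -> : delta Pr g g' = 0; last by lra.
  apply: big1 => h /andP[_ mlo].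
  have -> : inside h g = false by rewrite /inside; lia.
  by have -> : inside h g' = false by rewrite /inside; lia.
have [mg|gm] := leqP m g.
  have zm z : (g <= z <= g')%N -> (m <= z)%N by lia.
  rewrite big_ord_recl /= .
  rewrite (eq_bigr (fun i : 'I_L => tdist (M2 i) g g')); last first.
    move=> i _; apply: eq_tdist => // z hz.
    by rewrite (outl _ _ _ (cM1 i)) ?add0r // zm.
  rewrite [X in _ + (_ + X)](eq_bigr (fun i : 'I_L.+1 => tdist (B2 i) g g')); last first.
    move=> i _; apply: eq_tdist => // z hz; rewrite /bump /= add1n /=.
    by case: ifP => _; rewrite ?(outl _ _ _ (cB1 _)) ?(outl _ _ _ cQL) ?add0r // zm.
  rewrite (_ : tdist (fun g => B1 0%N g + QR g) g g' = tdist QR g g'); last first.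
    by apply: eq_tdist => // z hz; rewrite (outl _ _ _ (cB1 _)) ?add0r // zm.
  have := cov2 g g' gg'; have := tge0 QR _ _ gg'.
  have := tdist_ridge am mb PXx gg'; rewrite mg orbT => /(_ isT); rewrite -/F.
  rewrite dP; have -> : delta Pl g g' = 0; last by lra.
  apply: big1 => h /andP[_ him].
  have -> : inside h g = false by rewrite /inside; lia.
  by have -> : inside h g' = false by rewrite /inside; lia.
(* The gaps lie on both sides of [m]. All block contours vanish at [m], so the tree distance of a
   sum is at least the two heights, and these pay for the distances within the halves and for both
   moats. *)
have gmg' : (g <= m <= g')%N by lia.
have base f Q : contour a m Q f -> tdist f g m <= f g.
  move=> cf; apply: tdist_le => [|z _]; first lia.
  by rewrite (outl _ _ _ cf (leqnn m)); case: cf => /(_ z) + _ _; lra.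
have base' f Q : contour m b Q f -> tdist f m g' <= f g'.
  move=> cf; apply: tdist_le => [|z _]; first lia.
  by rewrite (outr _ _ _ cf (leqnn m)); case: cf => /(_ z) + _ _; lra.
have pair f1 f2 Q1 Q2 : contour a m Q1 f1 -> contour m b Q2 f2 ->
    f1 g + f2 g' <= tdist (fun x => f1 x + f2 x) g g'.
  move=> c1 c2; apply: le_trans (tdist_ge _ gmg').
  rewrite (outl _ _ _ c1 (leqnn m)) (outr _ _ _ c2 (leqnn m)).
  by rewrite (outl _ _ _ c1 (ltnW mg')) (outr _ _ _ c2 (ltnW gm)); lra.
have covM : \sum_(i < L) tdist (M1 i) g m + \sum_(i < L) tdist (M2 i) m g' <=
    \sum_(i < L) tdist (fun g => M1 i g + M2 i g) g g'.
  rewrite -big_split; apply: ler_sum => i _.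
  apply: le_trans (pair _ _ _ _ (cM1 i) (cM2 i)).
  by apply: lerD; [exact: base (cM1 i) | exact: base' (cM2 i)].
pose f1 i := fun g => if (i < L.+1)%N then B1 i g else QL g.
pose f2 i := fun g => if (0 < i)%N then B2 i.-1 g else QR g.
have covB : \sum_(i < L.+2) (f1 i g + f2 i g') <=
    \sum_(i < L.+2) tdist (fun x => f1 i x + f2 i x) g g'.
  apply: ler_sum => i _.
  apply: (pair _ _ (if (i < L.+1)%N then Pl else Px) (if (0 < i)%N then Pr else Px)).
    by rewrite /f1; case: ifP.
  by rewrite /f2; case: ifP.
rewrite /f1 /f2 big_split big_ord_recr [X in _ + X <= _]big_ord_recl /= ltnn in covB.
have eB1 : \sum_(i < L.+1) tdist (B1 i) g m <=
    \sum_(i < L.+1) (if (i < L.+1)%N then B1 i g else QL g).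
  by apply: ler_sum => i _; rewrite ltn_ord; exact: base (cB1 i).
have eB2 : \sum_(i < L.+1) tdist (B2 i) m g' <= \sum_(i < L.+1) B2 i g'.
  by apply: ler_sum => i _; exact: base' (cB2 i).
have := cov1 g m (ltnW gm); have := cov2 m g' (ltnW mg').
have := delta_cross am mb PXx gmg'; rewrite -/F -/QL -/QR.
have := tdist_norm_le F gg'.
rewrite dP.
have -> : delta Pl g g' = delta Pl g m.
  apply: eq_bigr => h /andP[_ him]; congr (_ *+ nat_of_bool (_ (+) _)).
  by rewrite /inside; lia.
have -> : delta Pr g g' = delta Pr m g'.
  apply: eq_bigr => h /andP[_ him]; congr (_ *+ nat_of_bool (_ (+) _)).
  by rewrite /inside; lia.
move: covB eB1 eB2 covM; lra.
Qed.

End Chords.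

(** * From contours to laminar chords *)

Section ContourChords.
Variable R : realFieldType.
Implicit Types (f : nat -> R) (g z : nat) (A B : nat * nat * R) (s : seq (nat * nat * R)).

Definition cut_off A g := (A.1.1 < g <= A.1.2)%N.

(** The relation is directed: [A] may contain [B] but may not lie properly inside it, so lists are
    ordered from outer to inner chords. Adjacent chords sharing a corner count as disjoint. *)
Definition laminar A B :=
  [|| (A.1.1 <= B.1.1) && (B.1.2 <= A.1.2), B.1.2 <= A.1.1 | A.1.2 <= B.1.1]%N.

Definition chord_ok n A := [&& (A.1.1 < A.1.2)%N, (A.1.2 < n)%N & 0 <= A.2].

Lemma max_run f n g0 : (forall g, 0 <= f g) -> (forall g, ~~ (0 < g < n)%N -> f g = 0) ->
  0 < f g0 -> exists i j, [/\ (i < g0 <= j)%N, f i = 0, f j.+1 = 0, (j < n)%N &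
    forall g, (i < g <= j)%N -> 0 < f g].
Proof.
move=> f0 fout fg0.
have g0n : (0 < g0 < n)%N by apply: contraTT fg0 => /fout ->; rewrite ltxx.
have exi : exists i, (i < g0)%N && (f i == 0).
  by exists 0%N; rewrite fout ?eqxx ?ltnn // andbT; lia.
have ubi i : (i < g0)%N && (f i == 0) -> (i <= g0)%N by lia.
have exj : exists j, (g0 < j)%N && (f j == 0).
  by exists n; rewrite fout ?eqxx ?ltnn ?andbF // andbT; lia.
case: (ex_maxnP exi ubi) => i /andP[ig /eqP fi] maxi.
case: (ex_minnP exj) => -[//|j] /andP[jg /eqP fj] minj.
have jn : (j < n)%N.
  by have := minj n; rewrite fout ?eqxx ?ltnn ?andbF // andbT; apply; lia.
exists i, j; split=> //; first by lia.
move=> g hg; rewrite lt_neqAle f0 andbT eq_sym; apply/negP => fg.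
have [|le|e] := ltngtP g g0.
- by move=> lt; have := maxi g; rewrite lt fg => /(_ isT); lia.
- by have := minj g; rewrite le fg => /(_ isT); lia.
by move: fg0; rewrite -e (eqP fg) ltxx.
Qed.

(** Peeling: the least positive height becomes the weight of one chord over the maximal positive run
    around [g0], and lowering the run by it makes [g0] vanish. Later chords cover only gaps where
    [f] is positive, hence lie inside the run or apart from it. *)
Lemma contour_chords_aux n N f :
  (\sum_(g < n) (0 < f g)%R < N)%N ->
  (forall g, 0 <= f g) -> (forall g, ~~ (0 < g < n)%N -> f g = 0) ->
  exists s, [/\ all (chord_ok n) s, pairwise laminar s,
    forall A g, A \in s -> cut_off A g -> 0 < f g,
    forall g, \sum_(A <- s) A.2 *+ cut_off A g = f g &
    forall g g', (g <= g')%N -> exists2 z, (g <= z <= g')%N &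
      f z <= \sum_(A <- s) A.2 *+ (cut_off A g && cut_off A g')].
Proof.
elim: N f => // N IHN f; rewrite ltnS => leN f0 fout.
have [/existsP[g1 fg1]|none] := boolP [exists g : 'I_n, 0 < f g]; last first.
  have fz g : f g = 0.
    have [gn|/fout//] := boolP (0 < g < n)%N.
    apply/eqP; rewrite eq_le f0 andbT leNgt; apply: contra none => fg.
    by apply/existsP; exists (Ordinal (proj2 (andP gn))).
  exists [::]; split=> // [g|g g' gg']; first by rewrite big_nil fz.
  by exists g; rewrite ?leqnn // big_nil fz.
case: (@arg_minP _ _ _ g1 (fun g : 'I_n => 0 < f g) (fun g : 'I_n => f g) fg1) => g0 fg0 ming0.
have [i [j [ig0j fi fj jn run]]] := max_run f0 fout fg0.
pose e := f g0; pose f' g := if (i < g <= j)%N then f g - e else f g.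
have eg g : 0 < f g -> e <= f g.
  move=> fg; have gn : (g < n)%N.
    by have /andP[] : (0 < g < n)%N by apply: contraTT fg => /fout ->; rewrite ltxx.
  exact: (ming0 (Ordinal gn)).
have f'0 g : 0 <= f' g by rewrite /f'; case: ifP => // /run/eg; rewrite subr_ge0.
have f'le g : f' g <= f g by rewrite /f'; case: ifP => // _; rewrite /e; lra.
have f'out g : ~~ (0 < g < n)%N -> f' g = 0.
  by move=> /fout fg; apply/eqP; rewrite eq_le f'0 -{1}fg f'le.
have lt' : (\sum_(g < n) (0 < f' g)%R < N)%N.
  apply: leq_trans leN; rewrite (bigD1 g0) // [X in (_ < X)%N](bigD1 g0) //=.
  rewrite fg0 {1}/f' ig0j subrr ltxx add0n add1n ltnS; apply: leq_sum => g _.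
  by case: (ltP 0 (f' g)) => //= h; rewrite (lt_le_trans h (f'le g)).
have [s [oks lams sups sums mins]] := IHN f' lt' f'0 f'out.
exists ((i, j, e) :: s); split.
- by rewrite /= oks andbT /chord_ok /= jn (ltW fg0) !andbT; lia.
- rewrite /= lams andbT; apply/allP => B Bs.
  have Bf g : cut_off B g -> 0 < f g by move=> /(sups _ _ Bs); move/lt_le_trans; apply.
  have := Bf i; have := Bf j.+1; rewrite fi fj ltxx /cut_off /laminar /=; lia.
- move=> A g; rewrite inE => /orP[/eqP -> /run//|As /(sups _ _ As)].
  by move/lt_le_trans; apply.
- move=> g; rewrite big_cons sums /f' /cut_off /=.
  by case: (_ < _ <= _)%N; rewrite ?mulr1n ?mulr0n ?add0r // addrC subrK.
move=> g g' gg'; have [z hz fz] := mins g g' gg'.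
have s0 : 0 <= \sum_(A <- s) A.2 *+ (cut_off A g && cut_off A g').
  by rewrite big_seq sumr_ge0 // => A /(allP oks)/and3P[_ _ w0]; rewrite mulrn_wge0.
rewrite big_cons /cut_off /=.
have [run_gg'|nrun] := boolP ((i < g <= j)%N && (i < g' <= j)%N).
  exists z => //; rewrite mulr1n; move: fz; rewrite /f'.
  by have -> : (i < z <= j)%N; [lia | rewrite /cut_off; lra].
(* A zero of [f] between [g] and [g'] serves as the witness. Without one, as the two are not both in
   the run, no gap between them is, and the lowering leaves [f z] unchanged. *)
have [/existsP[y /andP[gy /eqP fy]]|nz] :=
    boolP [exists y : 'I_g'.+1, (g <= y)%N && (f y == 0)].
  exists y; first by rewrite gy -ltnS ltn_ord.
  by rewrite fy mulr0n add0r.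
have pos y : (g <= y <= g')%N -> 0 < f y.
  case/andP => gy yg'; rewrite lt_neqAle f0 andbT eq_sym; apply: contra nz => fy.
  by apply/existsP; exists (Ordinal (yg' : (y < g'.+1)%N)); rewrite gy.
exists z => //; rewrite mulr0n add0r; move: fz; rewrite /f'; case: ifP => // zij.
have hi : ~ (g <= i <= g')%N by move=> /pos; rewrite fi ltxx.
have hj : ~ (g <= j.+1 <= g')%N by move=> /pos; rewrite fj ltxx.
by lia.
Qed.

Definition chords_dist s g g' := \sum_(A <- s) A.2 *+ (cut_off A g (+) cut_off A g').

(** A chord over both [g] and [g'] covers every gap between them, whence the first bound. Together
    the two bounds make the chord distance equal to [tdist f g g']. *)
Lemma contour_chords n f :
  (forall g, 0 <= f g) -> (forall g, ~~ (0 < g < n)%N -> f g = 0) ->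
  exists s, [/\ all (chord_ok n) s, pairwise laminar s,
    forall g g', (g <= g')%N -> tdist f g g' <= chords_dist s g g' &
    forall g g', (g <= g')%N -> exists2 z, (g <= z <= g')%N &
      chords_dist s g g' <= f g + f g' - 2 * f z].
Proof.
move=> f0 fout; have [s [oks lams _ sums mins]] := contour_chords_aux (ltnSn _) f0 fout.
have distE g g' : chords_dist s g g' = f g + f g' -
    2 * \sum_(A <- s) A.2 *+ (cut_off A g && cut_off A g').
  rewrite -!sums mulr_sumr -big_split -sumrB; apply: eq_bigr => A _ /=.
  by case: (cut_off A g); case: (cut_off A g') => /=; ring.
exists s; split=> // g g' gg'; last first.
  have [z hz le_z] := mins g g' gg'; exists z => //; rewrite distE; lra.
rewrite /tdist distE; have [z hz ->] := valley_attained f gg'.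
suff : \sum_(A <- s) A.2 *+ (cut_off A g && cut_off A g') <= f z by lra.
rewrite -sums big_seq [X in _ <= X]big_seq; apply: ler_sum => A /(allP oks)/and3P[_ _ w0].
apply: ler_wpMn2l => //; case: (boolP (_ && _)) => // /andP[h1 h2].
by have -> : cut_off A z by move: h1 h2; rewrite /cut_off; lia.
Qed.

End ContourChords.

(** * Kalmanson metrics *)

Section Kalmanson.
Variables (R : realFieldType) (n : nat) (d : nat -> nat -> R).
Hypothesis d_sym : forall i j, d i j = d j i.
Hypothesis d_diag : forall i, d i i = 0.
Hypothesis d_cross : forall i j k l, (i <= j <= k)%N -> (k <= l < n)%N ->
  d i j + d k l <= d i k + d j l /\ d j k + d i l <= d i k + d j l.

(** The cyclic predecessor: the gap [g] lies between the corners [cpred g] and [g], the gap 0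
    between the last corner and the first. *)
Definition cpred g := if g is g'.+1 then g' else n.-1.

(* Twice the weight of the split {g, g'} in the cut decomposition of d. *)
Definition split_wt g g' := d g g' + d (cpred g) (cpred g') - d (cpred g) g' - d g (cpred g').

Lemma split_wt_sym g g' : split_wt g g' = split_wt g' g.
Proof.
rewrite /split_wt (d_sym g g') (d_sym (cpred g) (cpred g')) (d_sym (cpred g) g').
by rewrite (d_sym g (cpred g')); ring.
Qed.

Lemma split_wt_ge0 g g' : (g < n)%N -> (g' < n)%N -> g != g' -> 0 <= split_wt g g'.
Proof.
wlog lt : g g' / (g < g')%N.
  move=> W gn g'n; rewrite neq_ltn => /orP[lt|lt]; last rewrite split_wt_sym.
    by apply: W => //; rewrite neq_ltn lt.
  by apply: W => //; rewrite neq_ltn lt.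
move=> gn g'n _; rewrite /split_wt; case: g' lt g'n => // g' lt g'n /=.
case: g gn lt => [|g] gn lt /=.
  have [||h1 h2] := @d_cross 0 g' g'.+1 n.-1; [lia|lia|].
  rewrite (d_sym n.-1 g') (d_sym n.-1 g'.+1); clear -h1 h2; lra.
have [||h1 h2] := @d_cross g g.+1 g' g'.+1; [lia|lia|]; lra.
Qed.

Lemma sum_cpred (G : nat -> R) : \sum_(g < n) (G g - G (cpred g)) = 0.
Proof.
rewrite /cpred; case: n => [|m]; first by rewrite big_ord0.
rewrite big_ord_recl /= -(big_mkord predT (fun i => G i.+1 - G i)) telescope_sumr //=.
ring.
Qed.

Lemma sum_cpred_in (G : nat -> R) lo hi : (lo <= hi < n)%N ->
  \sum_(g < n) (G g - G (cpred g)) *+ (lo < g <= hi)%N = G hi - G lo.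
Proof.
move=> /andP[lohi hin]; rewrite -(big_mkord predT (fun g => (G g - G (cpred g)) *+ (lo < g <= hi)%N)).
rewrite (@big_cat_nat _ _ _ lo.+1) //=; last lia.
rewrite (@big_cat_nat _ _ _ hi.+1 lo.+1) //=.
rewrite [X in X + _]big_nat_cond [X in X + _]big1 ?add0r; last first.
  by move=> g /andP[h _]; have -> : (lo < g <= hi)%N = false by lia.
rewrite [X in _ + X]big_nat_cond [X in _ + X]big1 ?addr0; last first.
  by move=> g /andP[h _]; have -> : (lo < g <= hi)%N = false by lia.
rewrite big_add1 /= (eq_big_nat _ _ (F2 := fun g => G g.+1 - G g)) ?telescope_sumr //.
by move=> g h; have -> : (lo < g.+1 <= hi)%N by lia.
Qed.

(** With the exclusive or expanded as [u + u' - 2 u u'], the linear terms telescope around the cycle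
    to 0 and the product term to [-2 d lo hi]. The factor 4 comes from the doubled weights and the
    ordered pairs. *)
Lemma kalmanson_cuts lo hi : (lo <= hi < n)%N ->
  4 * d lo hi = \sum_(g < n) \sum_(g' < n)
    split_wt g g' *+ ((lo < g <= hi)%N (+) (lo < g' <= hi)%N).
Proof.
move=> h; pose u g : R := (lo < g <= hi)%N%:R.
have E g g' : split_wt g g' *+ ((lo < g <= hi)%N (+) (lo < g' <= hi)%N) =
    split_wt g g' * u g + split_wt g g' * u g' - 2 * (split_wt g g' * u g * u g').
  rewrite /u; case: (lo < g <= hi)%N; case: (lo < g' <= hi)%N => /=; ring.
have S1 g : \sum_(g' < n) split_wt g g' = 0.
  rewrite -[RHS](sum_cpred (fun g' => d g g' - d (cpred g) g')).
  by apply: eq_bigr => g' _; rewrite /split_wt; ring.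
have S2 g : \sum_(g' < n) split_wt g g' * u g' =
    (d g hi - d g lo) - (d (cpred g) hi - d (cpred g) lo).
  transitivity ((d g hi - d (cpred g) hi) - (d g lo - d (cpred g) lo)); last by ring.
  rewrite -(sum_cpred_in (fun x => d g x - d (cpred g) x) h); apply: eq_bigr => g' _.
  by rewrite /u mulr_natr /split_wt; congr (_ *+ _); ring.
have S3 : \sum_(g < n) \sum_(g' < n) split_wt g g' * u g * u g' = - 2 * d lo hi.
  transitivity (\sum_(g < n) ((d g hi - d g lo) - (d (cpred g) hi - d (cpred g) lo)) *+ (lo < g <= hi)%N).
    apply: eq_bigr => g _; rewrite -S2 -mulr_natr mulr_suml; apply: eq_bigr => g' _.
    by rewrite mulrAC.
  rewrite (sum_cpred_in (fun x => d x hi - d x lo) h) !d_diag (d_sym hi lo); ring.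
have S4 : \sum_(g < n) \sum_(g' < n) split_wt g g' * u g = 0.
  by apply: big1 => g _; rewrite -mulr_suml S1 mul0r.
have S5 : \sum_(g < n) \sum_(g' < n) split_wt g g' * u g' = 0.
  rewrite exchange_big /=; apply: big1 => g' _.
  rewrite (eq_bigr (fun g : 'I_n => split_wt g' g * u g')) -?mulr_suml ?S1 ?mul0r //.
  by move=> g _; rewrite split_wt_sym.
transitivity (\sum_(g < n) \sum_(g' < n) split_wt g g' * u g +
  \sum_(g < n) \sum_(g' < n) split_wt g g' * u g' -
  2 * \sum_(g < n) \sum_(g' < n) split_wt g g' * u g * u g').
  by rewrite S3 S4 S5; ring.
rewrite mulr_sumr -big_split -sumrB; apply: eq_bigr => g _.
by rewrite mulr_sumr -big_split -sumrB; apply: eq_bigr => g' _; rewrite E.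
Qed.

End Kalmanson.

(** * Plane duality *)

(* If the rows of a and of b are orthogonal over F_2 and their ranks add up to at
   least #|E| (RA and RB bound the left kernels), each row space is the
   orthogonal complement of the other. *)
Section BinaryDuality.

Lemma natr_addb (x y : bool) : (x (+) y)%:R = x%:R + y%:R :> 'F_2.
Proof. by apply/val_inj; case: x; case: y. Qed.

Lemma natr_big_addb (I : finType) (P : pred I) (F : I -> bool) :
  (\big[addb/false]_(i | P i) F i)%:R = \sum_(i | P i) (F i)%:R :> 'F_2.
Proof. by apply: (big_morph (fun b : bool => b%:R : 'F_2) natr_addb). Qed.

Lemma natrF2_inj : injective (fun b : bool => b%:R : 'F_2).
Proof. by move=> [] [] // /(congr1 val). Qed.

Lemma F2_bool (x : 'F_2) : x = (x != 0)%:R.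
Proof. by apply/val_inj; case: x => -[|[|]]. Qed.

Variables (A B E : finType) (a : A -> E -> bool) (b : B -> E -> bool).
Hypothesis orth : forall x y, \big[addb/false]_e (a x e && b y e) = false.

Let mx (T : finType) (f : T -> E -> bool) : 'M['F_2]_(#|T|, #|E|) :=
  \matrix_(i, j) (f (enum_val i) (enum_val j))%:R.

Let sum_enum (T : finType) (F : T -> 'F_2) : \sum_(i < #|T|) F (enum_val i) = \sum_x F x.
Proof. by rewrite [RHS](eq_bigl (mem T)) // (big_enum_val (A := T) F). Qed.

Let rank_ker (T : finType) (f : T -> E -> bool) (S : {set T}) :
  (forall u : T -> bool, (forall e, \big[addb/false]_x (u x && f x e) = false) ->
     (forall x, x \in S -> u x = false) -> forall x, u x = false) ->
  (\rank (kermx (mx f)) <= #|S|)%N.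
Proof.
(* [P] restricts a kernel vector to the coordinates in [S]; by [roots] this is injective on the
   kernel. *)
move=> roots; pose P : 'M['F_2]_(#|T|, #|S|) :=
  \matrix_(i, j) (enum_val i == enum_val j :> T)%:R.
rewrite -(mxrank_mul_ker _ P) (_ : (_ :&: _)%MS = 0) ?mxrank0 ?addn0 ?rank_leq_col //.
apply/eqP/rowV0P => v; rewrite sub_capmx => /andP[/sub_kermxP vM /sub_kermxP vP].
pose u x := v 0 (enum_rank x) != 0.
have uv x : (u x)%:R = v 0 (enum_rank x) by rewrite /u -F2_bool.
suff u0 x : u x = false.
  apply/rowP => i; rewrite mxE -(enum_valK i) -uv u0 //.
apply: roots x => [e|x xS]; apply: natrF2_inj => /=.
  rewrite natr_big_addb -sum_enum.
  have /rowP/(_ (enum_rank e)) := vM; rewrite !mxE; apply: etrans; apply: eq_bigr => i _.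
  by rewrite mxE -mulnb natrM uv enum_valK enum_rankK.
have /rowP/(_ (enum_rank_in xS x)) := vP; rewrite !mxE; apply: etrans.
rewrite (bigD1 (enum_rank x)) //= mxE enum_rankK enum_rankK_in // eqxx mulr1 uv.
rewrite big1 ?addr0 // => i ix; rewrite mxE enum_rankK_in //.
by case: eqP => [e|_]; rewrite ?mulr0 //; rewrite -e enum_valK eqxx in ix.
Qed.

Lemma binary_duality (RA : {set A}) (RB : {set B}) :
  (forall u : A -> bool, (forall e, \big[addb/false]_x (u x && a x e) = false) ->
     (forall x, x \in RA -> u x = false) -> forall x, u x = false) ->
  (forall u : B -> bool, (forall e, \big[addb/false]_x (u x && b x e) = false) ->
     (forall x, x \in RB -> u x = false) -> forall x, u x = false) ->
  (#|E| + #|RA| + #|RB| <= #|A| + #|B|)%N ->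
  forall z : E -> bool, (forall y, \big[addb/false]_e (z e && b y e) = false) ->
  exists u : A -> bool, forall e, z e = \big[addb/false]_x (u x && a x e).
Proof.
move=> rootsA rootsB card_le z zB.
pose rv : 'rV['F_2]_#|E| := \row_j (z (enum_val j))%:R.
have kerMA : (mx a <= kermx (mx b)^T)%MS.
  apply/sub_kermxP/matrixP => i j; rewrite !mxE.
  transitivity (\sum_e ((a (enum_val i) e && b (enum_val j) e)%:R : 'F_2)).
    by rewrite -sum_enum; apply: eq_bigr => k _; rewrite !mxE -mulnb natrM.
  by rewrite -natr_big_addb orth.
have kerz : (rv <= kermx (mx b)^T)%MS.
  apply/sub_kermxP/rowP => j; rewrite !mxE.
  transitivity (\sum_e ((z e && b (enum_val j) e)%:R : 'F_2)).
    by rewrite -sum_enum; apply: eq_bigr => k _; rewrite !mxE -mulnb natrM.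
  by rewrite -natr_big_addb zB.
have eqker : (mx a == kermx (mx b)^T)%MS.
  rewrite -(geq_leqif (mxrank_leqif_eq kerMA)).
  have := rank_ker rootsA; have := rank_ker rootsB; rewrite !mxrank_ker mxrank_tr.
  move: card_le (rank_leq_row (mx a)) (rank_leq_row (mx b)) (rank_leq_col (mx b)); lia.
have /submxP[D rvD] : (rv <= mx a)%MS by rewrite (eqmxP eqker).
exists (fun x => D 0 (enum_rank x) != 0) => e; apply: natrF2_inj => /=.
rewrite natr_big_addb -sum_enum.
have /rowP/(_ (enum_rank e)) := rvD; rewrite !mxE enum_rankK => ->.
by apply: eq_bigr => i _; rewrite !mxE -mulnb natrM -F2_bool enum_valK enum_rankK.
Qed.

End BinaryDuality.

Section Planar.
Variables (V E : finType) (ends : E -> V * V) (sigma : {perm E * bool}).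
Hypothesis planar : planar_rotation ends sigma.

Local Notation dart := (E * bool)%type.
Local Notation fm := (facemap sigma).
Local Notation dtail := (dtail ends).
Local Notation dhead := (dhead ends).
Implicit Types (d : dart) (e : E) (F : {set dart}) (X : {set V}) (Z S : {set E}).

Lemma drevK : involutive (@drev E).
Proof. by case=> e b; rewrite /drev /= negbK. Qed.

Lemma facemap_inj : injective fm.
Proof. by move=> d d' /perm_inj /(can_inj drevK). Qed.

Lemma dtail_rev d : dtail (drev d) = dhead d.
Proof. by rewrite /Defs.dtail /Defs.dhead /=; case: d.2. Qed.

Lemma sigma_facemap d : sigma d = fm (drev d).
Proof. by rewrite /facemap drevK. Qed.

Lemma dtail_facemap d : dtail (fm d) = dhead d.
Proof. by rewrite /facemap (proj1 (proj1 planar)) dtail_rev. Qed.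

Definition face d : {set dart} := [set d' | fconnect fm d d'].

Lemma face_in d : face d \in dfaces sigma.
Proof. by apply/imsetP; exists d. Qed.

Lemma mem_face d : d \in face d.
Proof. by rewrite inE. Qed.

Lemma face_eqP d d' : reflect (face d = face d') (fconnect fm d d').
Proof.
apply: (iffP idP) => [h|/setP/(_ d')]; last by rewrite !inE connect0.
by apply/setP => x; rewrite !inE (same_connect (fconnect_sym facemap_inj) h).
Qed.

Lemma face_facemap d : face (fm d) = face d.
Proof. by apply/esym/face_eqP; exact: fconnect1. Qed.

Lemma faceE F d : F \in dfaces sigma -> (d \in F) = (face d == F).
Proof.
case/imsetP => d0 _ ->; rewrite -/(face d0) inE.
by apply/idP/eqP => [/face_eqP ->|/esym/face_eqP].
Qed.

Definition chain F e := ((e, false) \in F) (+) ((e, true) \in F).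

Lemma addb_darts (c : E -> bool) (f : dart -> bool) :
  \big[addb/false]_e (c e && (f (e, false) (+) f (e, true))) =
  \big[addb/false]_d (c d.1 && f d).
Proof.
transitivity (\big[addb/false]_e \big[addb/false]_b (c e && f (e, b))).
  by apply: eq_bigr => e _; rewrite big_bool /= -andb_addr addbC.
by rewrite pair_bigA /=; apply: eq_bigr => -[e b].
Qed.

Lemma crossing_dart X d : crossing X (ends d.1) = (dtail d \in X) (+) (dhead d \in X).
Proof. by rewrite crossingE /Defs.dtail /Defs.dhead; case: d.2; rewrite // addbC. Qed.

(** Facial walks are closed: reindexing by the face map turns a sum over tails into one over heads,
    so the boundary of an invariant set of darts meets every cut evenly. *)
Lemma facemap_inv_even (phi : dart -> bool) X : (forall d, phi (fm d) = phi d) ->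
  \big[addb/false]_e (crossing X (ends e) && (phi (e, false) (+) phi (e, true))) = false.
Proof.
move=> inv; rewrite (addb_darts (fun e => crossing X (ends e))).
under eq_bigr do rewrite crossing_dart andb_addl.
rewrite big_split /= [X in X (+) _](reindex_inj facemap_inj) /=.
by under eq_bigr do rewrite dtail_facemap inv; rewrite addbb.
Qed.

Lemma chain_sum (c : E -> bool) F :
  \big[addb/false]_e (c e && chain F e) = \big[addb/false]_(d in F) c d.1.
Proof.
rewrite (addb_darts c (fun d => d \in F)) [RHS]big_mkcond; apply: eq_bigr => d _.
by case: (d \in F); rewrite ?andbT ?andbF.
Qed.

Lemma adj_sym : connect_sym (adj ends).
Proof. by apply: sym_connect_sym => u w; apply: eq_existsb => e; rewrite orbC. Qed.

Lemma isolatedPn v : reflect (exists d, dtail d = v) (~~ isolated ends v).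
Proof.
apply: (iffP idP) => [|[d dv]].
  rewrite negb_forall => /existsP[e]; rewrite negbK => /orP[]/eqP ev.
    by exists (e, false).
  by exists (e, true).
rewrite negb_forall; apply/existsP; exists d.1; rewrite negbK -dv.
by rewrite /incident /Defs.dtail; case: d.2; rewrite eqxx ?orbT.
Qed.

Lemma isolated_adj v w : isolated ends v -> connect (adj ends) v w -> v = w.
Proof.
move=> iv /connectP[[|x p] /=]; first by move=> _ ->.
case/andP => /existsP[e he] _ _; case/negP: (forallP iv e).
by rewrite /incident; case/orP: he => /eqP -> /=; rewrite eqxx ?orbT.
Qed.

Lemma vertex_roots (u : V -> bool) :
  (forall e, u (ends e).1 = u (ends e).2) ->
  (forall v, v \in roots (adj ends) -> u v = false) -> forall v, u v = false.
Proof.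
move=> ue ur v.
have <- : u (fingraph.root (adj ends) v) = false by apply: ur; exact: (roots_root adj_sym).
have /connectP[p pp ->] := connect_root (adj ends) v.
elim: p v pp => //= w p IHp v /andP[vw /IHp <-].
case/existsP: vw => e /orP[]/eqP he; have := ue e; rewrite he //=.
Qed.

(** One face for each component that has an edge, taken at a dart of the root vertex. A dependency
    between face boundaries that vanishes on these faces is zero. *)
Definition face_roots : {set {set dart}} :=
  [set face d | d : dart & d \in pmap (fun v => [pick d | dtail d == v])
    (enum [pred v | (v \in roots (adj ends)) && ~~ isolated ends v])].

Lemma card_face_roots : (#|face_roots| + #|[set v | isolated ends v]| <= ncomp ends)%N.
Proof.
have -> : ncomp ends = (#|[pred v | (v \in roots (adj ends)) && ~~ isolated ends v]| +
    #|[set v | isolated ends v]|)%N.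
  rewrite /ncomp /n_comp_mem.
  rewrite -(cardID [pred v | ~~ isolated ends v] (predI (roots _) _)).
  congr (_ + _)%N; first by apply: eq_card => v; rewrite !inE /= andbT.
  apply: eq_card => v; rewrite !inE /= negbK andbT; case: (boolP (isolated ends v)) => //= iv.
  by rewrite /roots /= -(isolated_adj iv (connect_root _ _)) eqxx.
rewrite leq_add2r [X in (_ <= X)%N]cardE; apply: leq_trans (leq_imset_card _ _) _.
rewrite cardsE; apply: leq_trans (card_size _) _.
by rewrite size_pmap; apply: count_size.
Qed.

(** The rotation is reversal followed by the face map, so [phi] is constant on the darts at a vertex
    and, by reversal, on each component. *)
Lemma dart_roots (phi : dart -> bool) :
  (forall d, phi (fm d) = phi d) -> (forall d, phi (drev d) = phi d) ->
  (forall d, face d \in face_roots -> phi d = false) -> forall d, phi d = false.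
Proof.
move=> inv rev root0.
have sig d : phi (sigma d) = phi d by rewrite sigma_facemap inv rev.
have tl d d' : dtail d = dtail d' -> phi d = phi d'.
  move=> /(proj2 (proj1 planar)) /iter_findex <-.
  by elim: (findex _ _ _) => //= i ->; rewrite sig.
have con v w d : connect (adj ends) v w -> dtail d = v ->
    exists2 d', dtail d' = w & phi d' = phi d.
  case/connectP => p + ->; elim: p v d => [|x p IHp] v d /=.
    by move=> _ dv; exists d.
  case/andP => vx pp dv.
  have [d1 d1v d1x] : exists2 d1, dtail d1 = v & dhead d1 = x.
    by case/existsP: vx => e /orP[]/eqP he; [exists (e, false) | exists (e, true)];
       rewrite /Defs.dtail /Defs.dhead /= he.
  have [|d' d'w e'] := IHp x (drev d1) pp; first by rewrite dtail_rev.
  by exists d' => //; rewrite e' rev; apply: tl; rewrite d1v dv.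
move=> d.
have [d' d'r <-] := con _ _ d (connect_root (adj ends) _) erefl.
set v := fingraph.root _ _ in d'r.
have vin : v \in [pred v | (v \in roots (adj ends)) && ~~ isolated ends v].
  apply/andP; split; first exact: (roots_root adj_sym).
  by apply/isolatedPn; exists d'.
have [d2 pd2] : exists d2, [pick d | dtail d == v] = Some d2.
  by case: pickP => [d2 _|/(_ d')]; [exists d2 | rewrite d'r eqxx].
have d2v : dtail d2 = v by move: pd2; case: pickP => // x /eqP xv [<-].
rewrite (tl d' d2) ?d'r ?d2v //; apply: root0; apply/imsetP; exists d2 => //.
by rewrite inE mem_pmap; apply/mapP; exists v; rewrite ?mem_enum.
Qed.

Let va v e := crossing [set v] (ends e).
(** Rows are indexed by all dart sets, and those that are not faces give zero rows; this is why the
    complement of [dfaces sigma] enters the bound on the left kernel. *)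
Let fb F e := (F \in dfaces sigma) && chain F e.

Let sum_va (u : V -> bool) e :
  \big[addb/false]_v (u v && va v e) = u (ends e).1 (+) u (ends e).2.
Proof.
have pick1 x : \big[addb/false]_v (u v && (x == v)) = u x.
  rewrite (bigD1 x) //= eqxx andbT big1 ?addbF // => v /negPf.
  by rewrite eq_sym => ->; rewrite andbF.
rewrite -[RHS](congr2 addb (pick1 _) (pick1 _)) -big_split; apply: eq_bigr => v _.
by rewrite /va crossingE !inE andb_addr.
Qed.

Let sum_fb (u : {set dart} -> bool) e :
  \big[addb/false]_F (u F && fb F e) = u (face (e, false)) (+) u (face (e, true)).
Proof.
have pick1 d : \big[addb/false]_F (u F && ((F \in dfaces sigma) && (d \in F))) = u (face d).
  rewrite (bigD1 (face d)) //= face_in mem_face /= andbT big1 ?addbF // => F nF.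
  case: (boolP (F \in _)) => //= Fd; last by rewrite andbF.
  by rewrite faceE // eq_sym (negPf nF) andbF.
rewrite -[RHS](congr2 addb (pick1 _) (pick1 _)) -big_split; apply: eq_bigr => F _.
by rewrite /fb /chain /=; case: (u F); case: (F \in _); rewrite ?addbF ?andbF.
Qed.

Let orth v F : \big[addb/false]_e (va v e && fb F e) = false.
Proof.
rewrite /fb; case: (boolP (F \in _)) => [FF|_]; last by rewrite big1 // => e _; rewrite andbF.
rewrite /= /chain (facemap_inv_even _ (phi := fun d => d \in F)) // => d.
by rewrite !faceE // face_facemap.
Qed.

Let rootsV (u : V -> bool) :
  (forall e, \big[addb/false]_v (u v && va v e) = false) ->
  (forall v, v \in [set v | v \in roots (adj ends)] -> u v = false) -> forall v, u v = false.
Proof.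
move=> ue ur; apply: vertex_roots => [e|v vr]; last by apply: ur; rewrite inE.
by have := ue e; rewrite sum_va; case: (u _); case: (u _).
Qed.

Let rootsF (u : {set dart} -> bool) :
  (forall e, \big[addb/false]_F (u F && fb F e) = false) ->
  (forall F, F \in ~: dfaces sigma :|: face_roots -> u F = false) -> forall F, u F = false.
Proof.
move=> ue ur F; have [FF|nF] := boolP (F \in dfaces sigma); last first.
  by apply: ur; rewrite !inE nF.
case/imsetP: FF => d _ ->; rewrite -/(face d).
apply: (dart_roots (phi := fun d => u (face d))) d => [d|[e b]|d dr].
- by rewrite face_facemap.
- have := ue e; rewrite sum_fb /drev /=.
  by case: b => /=; case: (u _); case: (u _).
by apply: ur; rewrite inE dr orbT.
Qed.

(** Euler's formula as the rank condition of [binary_duality]: the vertex rows have one dependency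
    per component, the face rows one per component with an edge, besides the zero rows. *)
Let euler : (#|E| + #|[set v | v \in roots (adj ends)]| +
   #|~: dfaces sigma :|: face_roots| <= #|V| + #|{set dart}|)%N.
Proof.
have := proj2 planar; have := card_face_roots.
have -> : #|[set v | v \in roots (adj ends)]| = ncomp ends.
  by rewrite /ncomp /n_comp_mem cardsE; apply: eq_card => v; rewrite !inE andbT.
have := cardsC (dfaces sigma); have := (leq_card_setU (~: dfaces sigma) face_roots).1.
move=> cU <- fr eu; apply: leq_trans (leq_add (leqnn _) cU) _.
by move: fr eu; do ![set x := #|_|]; lia.
Qed.

(** The cut space is the full orthogonal complement of the face boundaries. *)
Lemma dual_even_cut Z : (forall F, F \in dfaces sigma ->
    \big[addb/false]_e ((e \in Z) && chain F e) = false) ->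
  exists X, forall e, (e \in Z) = crossing X (ends e).
Proof.
move=> ev; have [|u hu] := binary_duality orth rootsV rootsF euler (z := fun e => e \in Z).
  move=> F; rewrite /fb; case: (boolP (F \in dfaces sigma)) => [/ev//|_].
  by rewrite big1 // => e _; rewrite andbF.
by exists [set v | u v] => e; rewrite hu sum_va crossingE !inE.
Qed.

(** The same duality with the roles exchanged; [phi] is the indicator of a set of faces, read on
    darts. *)
Lemma even_face_boundary S : (forall X, par ends S X = false) ->
  exists phi : dart -> bool, (forall d, phi (fm d) = phi d) /\
    forall e, (e \in S) = phi (e, false) (+) phi (e, true).
Proof.
move=> ev.
have orth' F v : \big[addb/false]_e (fb F e && va v e) = false.
  by apply: etrans (orth v F); apply: eq_bigr => e _; rewrite andbC.
have euler' : (#|E| + #|~: dfaces sigma :|: face_roots| +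
    #|[set v | v \in roots (adj ends)]| <= #|{set dart}| + #|V|)%N.
  by move: euler; lia.
have [|u hu] := binary_duality orth' rootsF rootsV euler' (z := fun e => e \in S).
  by move=> v; apply: ev.
exists (fun d => u (face d)); split=> [d|e]; first by rewrite face_facemap.
by rewrite hu sum_fb.
Qed.

End Planar.

(** * Cuts and joins along a face *)

Section FaceDistance.
Variables (V E : finType) (ends : E -> V * V) (sigma : {perm E * bool}).
Hypothesis planar : planar_rotation ends sigma.

Local Notation dart := (E * bool)%type.
Local Notation fm := (facemap sigma).
Local Notation dtail := (dtail ends).
Local Notation dhead := (dhead ends).
Local Notation face := (face sigma).
Implicit Types (d : dart) (e : E) (F : {set dart}) (X : {set V}) (Z S : {set E}).

Definition dual_ends e := (face (e, false), face (e, true)).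

Lemma chain_dual F e : F \in dfaces sigma -> chain F e = crossing [set F] (dual_ends e).
Proof. by move=> FF; rewrite /chain crossingE !inE !(faceE _ FF). Qed.

Lemma cut_dual_even X (U : {set {set dart}}) :
  par dual_ends [set e | crossing X (ends e)] U = false.
Proof.
have inv d : (face (fm d) \in U) = (face d \in U) by rewrite face_facemap.
apply: etrans (facemap_inv_even planar X inv).
by apply: eq_bigr => e _; rewrite inE [crossing U _]crossingE.
Qed.

(** A smallest nonempty dually even subset of the cut is a simple dual cycle: it is again a cut by
    [dual_even_cut], and it passes through each face at most once. *)
Lemma simple_dual_cut X : (exists e, crossing X (ends e)) ->
  exists X1, [/\ forall e, crossing X1 (ends e) -> crossing X (ends e),
    exists e, crossing X1 (ends e) &
    forall d0, (#|[set d in face d0 | crossing X1 (ends d.1)]| <= 2)%N].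
Proof.
case=> e0 e0X; pose Z := [set e | crossing X (ends e)].
pose even Z' := [forall U, par dual_ends Z' U == false].
have evenP Z' : reflect (forall U, par dual_ends Z' U = false) (even Z').
  by apply: (iffP forallP) => H U; apply/eqP/H.
pose ok Z' := [&& Z' \subset Z, Z' != set0 & even Z'].
have okZ : ok Z.
  rewrite /ok subxx /=; apply/andP; split; first by apply/set0Pn; exists e0; rewrite inE.
  by apply/evenP => U; exact: cut_dual_even.
case: (@arg_minnP _ Z ok (fun Z' => #|Z'|) okZ) => Z1 /and3P[Z1Z nz /evenP ev1] min1.
have minZ Z' : Z' \subset Z1 -> Z' != set0 -> even Z' -> Z' = Z1.
  move=> sub ne ev; apply/eqP; rewrite eqEcard sub /=; apply: min1.
  by rewrite /ok ne ev (subset_trans sub Z1Z).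
have [|X1 hX1] := dual_even_cut planar (Z := Z1).
  move=> F FF; apply: etrans (ev1 [set F]); apply: eq_bigr => e _.
  by rewrite chain_dual.
exists X1; split=> [e|| d0].
- by rewrite -hX1 => /(subsetP Z1Z); rewrite inE.
- by case/set0Pn: nz => e eZ; exists e; rewrite -hX1.
set F := face d0.
have FF : F \in dfaces sigma by exact: face_in.
have [->|/set0Pn[[e b]]] := eqVneq [set d in F | crossing X1 (ends d.1)] set0.
  by rewrite cards0.
rewrite !inE -hX1 /= => /andP[dF eZ]; have eF : (e, b) \in F by rewrite inE.
have [loop|nloop] := boolP ((face (e, false) == F) && (face (e, true) == F)).
  have Z1e : [set e] = Z1.
    apply: minZ; rewrite ?sub1set //; first by apply/set0Pn; exists e; rewrite inE.
    apply/evenP => U; rewrite par1 crossingE /=.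
    by case/andP: loop => /eqP -> /eqP ->; rewrite addbb.
  apply: (@leq_trans #|[set (e, false); (e, true)]|); last by rewrite cards2; case: (_ != _).
  apply/subset_leq_card/subsetP => -[g b']; rewrite !inE -hX1 -Z1e inE /=.
  by case/andP=> _ /eqP ->; case: b'; rewrite !xpair_eqE !eqxx.
(* The rest of the cycle is followed from [F'], the other side of [e], to its first arrival in [F]
   through [f]. Together with [e] this closes up, so by minimality it is all of [Z1], and only [e]
   and [f] border [F]. *)
have [F' F'F je] : exists2 F', F' != F & joins dual_ends [set e] F' F.
  have := joins1 dual_ends e; rewrite /= => j.
  move: eF nloop; rewrite (faceE _ FF); case: b {dF} => /eqP h; rewrite h eqxx ?andbT => ne.
    by exists (face (e, false)); rewrite // -h.
  by exists (face (e, true)); rewrite // joins_sym -h.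
have jP : joins dual_ends (symd Z1 [set e]) F' F.
  by apply/joins_parP => U; rewrite par_symd ev1 (joins_parP _ _ _ _ je).
have F'K : F' \notin [set F] by rewrite inE.
have [f [x [P0 [fP fK xK [P0P fP0 P0K] jP1]]]] := joins_first_arrival jP F'K (set11 F).
move: xK; rewrite inE => /eqP xF; rewrite xF in jP1.
have eP : e \notin symd Z1 [set e] by rewrite in_symd eZ inE eqxx.
have PZ g : g \in symd Z1 [set e] -> g \in Z1.
  by rewrite in_symd inE; case: eqP => [->|]; rewrite ?eZ ?addbF.
have Z1E : symd (f |: P0) [set e] = Z1.
  apply: minZ.
  - apply/subsetP => g; rewrite in_symd in_setU1 in_set1; have [->//|_] := eqVneq g e; rewrite addbF.
    by case/orP => [/eqP ->|/(subsetP P0P)]; exact: PZ.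
  - apply/set0Pn; exists e.
    rewrite in_symd in_setU1 in_set1 eqxx (negPf (contra (subsetP P0P e) eP)) orbF.
    by case: eqP => // ef; rewrite -ef (negPf eP) in fP.
  apply/evenP => U; rewrite par_symd (joins_parP _ _ _ _ jP1) (joins_parP _ _ _ _ je).
  by rewrite addbb.
have eK : crossing [set F] (dual_ends e).
  move: nloop eF; rewrite crossingE !in_set1 /= (faceE _ FF).
  by case: b {dF} => /= h /eqP e'; move: h; rewrite e' eqxx ?andbT ?addbT.
have one g b' : crossing [set F] (dual_ends g) -> (g, b') \in F ->
    (g, b') = (g, face (g, true) == F).
  rewrite crossingE !in_set1 /= (faceE _ FF); case: b' => h /eqP e'; move: h; rewrite e' eqxx //=.
  by case: (_ == F).
apply: (@leq_trans #|[set (e, face (e, true) == F); (f, face (f, true) == F)]|); last first.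
  by rewrite cards2; case: (_ != _).
apply/subset_leq_card/subsetP => -[g b']; rewrite inE => /andP[gF].
rewrite -hX1 -Z1E in_symd in_setU1 !in_set1 in_set2.
have [ge|ge] := eqVneq g e => /=.
  by rewrite ge in gF *; rewrite -(one e b') ?eqxx.
rewrite addbF => /orP[/eqP gf|gP0].
  by rewrite gf in gF *; rewrite -(one f b') ?eqxx ?orbT.
move: (P0K _ gP0) gF; rewrite !in_set1 /= (faceE _ FF) => /andP[h1 h2].
by case: b' => h; rewrite h in h1 h2.
Qed.

Section Corners.
Variable d0 : dart.
Local Notation n := (fingraph.order fm d0).
Local Notation y g := (iter g fm d0).
Implicit Types (g i j k lo hi : nat).

(** The gap [g] of the face is the dart [y g], so the corner between the gaps [g] and [g.+1] is the
    head of that dart. *)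
Definition corner g := dhead (y g).

Definition face_arc lo hi : {set dart} := [set d in face d0 | (lo < findex fm d0 d <= hi)%N].

Lemma mem_arc lo hi g : (g < n)%N -> (y g \in face_arc lo hi) = (lo < g <= hi)%N.
Proof. by move=> gn; rewrite !inE fconnect_iter findex_iter. Qed.

Lemma arc_face lo hi d : d \in face_arc lo hi -> face d = face d0.
Proof. by rewrite inE => /andP[]; rewrite inE => /face_eqP -> //; exact: facemap_inj. Qed.

Lemma face_iter d : d \in face d0 -> exists2 g, (g < n)%N & d = y g.
Proof.
by rewrite inE => h; exists (findex fm d0 d); rewrite ?findex_max ?iter_findex.
Qed.

Lemma dtail_iter g : dtail (y g.+1) = corner g.
Proof. by rewrite iterS (dtail_facemap planar). Qed.

Lemma arc_boundary X lo hi : (lo <= hi < n)%N ->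
  \big[addb/false]_(d in face_arc lo hi) crossing X (ends d.1) = (corner lo \in X) (+) (corner hi \in X).
Proof.
elim: hi => [|hi IHhi] h.
  have -> : lo = 0%N by lia.
  rewrite addbb big1 // => d; rewrite inE => /andP[_]; lia.
have [->|lohi] := eqVneq lo hi.+1.
  rewrite addbb big1 // => d; rewrite inE => /andP[_]; lia.
have -> : face_arc lo hi.+1 = y hi.+1 |: face_arc lo hi.
  apply/setP => d; have [/face_iter[g gn ->]|dF] := boolP (d \in face d0); last first.
    rewrite /face_arc in_setU1 2!in_set (negPf dF) orbF; apply/esym/negbTE; apply: contra dF => /eqP ->.
    by rewrite inE fconnect_iter.
  rewrite in_setU1 !mem_arc //.
  have -> : (y g == y hi.+1) = (g == hi.+1).
    apply/eqP/eqP => [e|-> //]; rewrite -(findex_iter gn) e findex_iter //; lia.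
  lia.
rewrite big_setU1; last by rewrite mem_arc; lia.
rewrite IHhi; last lia.
rewrite crossing_dart dtail_iter -/(corner hi.+1).
by case: (_ \in X); case: (_ \in X); case: (_ \in X).
Qed.

Definition arc_edges lo hi := [set e | chain (face_arc lo hi) e].

Lemma arc_joins lo hi : (lo <= hi < n)%N -> joins ends (arc_edges lo hi) (corner lo) (corner hi).
Proof.
move=> h; apply/joins_parP => X; rewrite -(arc_boundary X h) -(chain_sum (fun e => crossing X (ends e))).
by apply: eq_bigr => e _; rewrite inE andbC.
Qed.

(* Joins of interlaced pairs of corners of a face meet: otherwise a face set
   bounded by S and an arc would separate the corners j and l, although it is
   constant along the join of these corners, which avoids S. *)
Lemma interlaced_meet S S' i j k l : (i <= j <= k)%N -> (k <= l < n)%N ->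
  joins ends S (corner i) (corner k) -> joins ends S' (corner j) (corner l) ->
  exists2 u, connect (step ends S) (corner i) u & connect (step ends S') (corner j) u.
Proof.
move=> ijk kln jS jS'.
pose W := [set v | connect (step ends S) (corner i) v].
pose A := [set v | connect (step ends S') (corner j) v].
have [/existsP[u /andP[]]|] := boolP [exists u, (u \in W) && (u \in A)].
  by rewrite !inE => uW uA; exists u.
rewrite negb_exists => /forallP noWA; exfalso.
have AW u : u \in A -> u \notin W by have := noWA u; case: (u \in W) => //=; case: (u \in A).
have iW : corner i \in W by rewrite inE connect0.
have kW : corner k \in W by rewrite inE; exact: joins_connect.
have jA : corner j \in A by rewrite inE connect0.
have lA : corner l \in A by rewrite inE; exact: joins_connect.
have jk : (j < k)%N.
  rewrite ltn_neqAle; case/andP: ijk => _ ->; rewrite andbT; apply/eqP => jk.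
  by have := AW _ jA; rewrite jk kW.
have kl : (k < l)%N.
  rewrite ltn_neqAle; case/andP: kln => -> _; rewrite andbT; apply/eqP => kl.
  by have := AW _ lA; rewrite -kl kW.
(* Only the component of [S] at the corner [i] is kept, so that no edge of [S0] touches a vertex
   outside [W]. *)
pose S0 := [set e in S | (ends e).1 \in W].
have jS0 : joins ends S0 (corner i) (corner k).
  apply/joins_parP => U; have /joins_parP/(_ (U :&: W)) := jS.
  rewrite !in_setI iW kW !andbT => <-; apply: eq_bigr => e _.
  rewrite !inE; case: (boolP (e \in S)) => //= eS.
  rewrite !crossingE !in_setI ![_ \in W]inE (connect_step_closed ends (corner i) eS).
  by case: (connect _ _ _); rewrite ?andbT ?andbF.
have [|Phi [Phi_inv PhiE]] := even_face_boundary planar (S := symd S0 (arc_edges i k)).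
  move=> X; rewrite par_symd (joins_parP _ _ _ _ jS0) (joins_parP _ _ _ _ (arc_joins _)).
    by rewrite addbb.
  by lia.
(* The correction cancels the arc from the boundary: [phi] changes across an edge exactly when it
   lies in [S0], and along a facial walk only at the corners [i] and [k], which belong to [W]. *)
pose phi d := Phi d (+) (d \in face_arc i k).
have phi_rev d : phi (drev d) = phi d (+) (d.1 \in S0).
  case: d => e b; have := PhiE e; rewrite in_symd [e \in arc_edges _ _]inE /chain /phi /drev /=.
  case: b => /=; case: (e \in S0); case: (Phi (e, false)); case: (Phi (e, true));
    case: ((e, false) \in face_arc i k); by case: ((e, true) \in face_arc i k).
have phi_fm d : dhead d \notin W -> phi (fm d) = phi d.
  move=> dW; rewrite /phi Phi_inv; congr addb.
  have [/face_iter[g gn dg]|dF] := boolP (d \in face d0); last first.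
    have nin x : x \notin face d0 -> (x \in face_arc i k) = false.
      by move=> h; apply/negbTE; apply: contra h; rewrite inE => /andP[].
    rewrite !nin //; apply: contra dF; rewrite !inE => h; apply: connect_trans h _.
    by rewrite (fconnect_sym (@facemap_inj _ sigma)) fconnect1.
  have gi : g != i by apply: contra dW => /eqP gi; rewrite dg gi.
  have gk : g != k by apply: contra dW => /eqP gk; rewrite dg gk.
  have [gn'|gn'] := ltnP g.+1 n.
    by rewrite dg -iterS !mem_arc //; lia.
  have -> : fm d = y 0.
    have e : g.+1 = n by lia.
    by rewrite dg -iterS e (iter_order (@facemap_inj _ sigma)).
  by rewrite dg !mem_arc ?order_gt0 //; lia.
have nS0 d : dtail d \notin W -> d.1 \notin S0.
  apply: contra; rewrite inE => /andP[dS dW].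
  rewrite /Defs.dtail; case: d.2 => //.
  by move: dW; rewrite !inE (connect_step_closed ends (corner i) dS).
have phi_tail d d' : dtail d \notin W -> dtail d = dtail d' -> phi d = phi d'.
  move=> dW /(proj2 (proj1 planar)) /iter_findex <-.
  suff H m : phi d = phi (iter m sigma d) /\ dtail (iter m sigma d) = dtail d.
    by case: (H (findex sigma d d')).
  elim: m => [//|m [IH IHt]]; rewrite iterS (proj1 (proj1 planar)) IHt; split=> //.
  rewrite IH sigma_facemap phi_fm; first by rewrite phi_rev (negPf (nS0 _ _)) ?addbF // IHt.
  by rewrite -dtail_rev drevK IHt.
have phi_path v p d : path (step ends S') v p -> v \in A -> dtail d = v ->
    exists2 d', dtail d' = last v p & phi d' = phi d.
  elim: p v d => [|x p IHp] v d /=; first by move=> _ _ dv; exists d.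
  case/andP => vx pp vA dv.
  have xA : x \in A by rewrite inE in vA; rewrite inE; apply: connect_trans vA (connect1 vx).
  have [d1 d1v d1x] : exists2 d1, dtail d1 = v & dhead d1 = x.
    by case/existsP: vx => e /andP[_ /orP[]/eqP he]; [exists (e, false) | exists (e, true)];
       rewrite /Defs.dtail /Defs.dhead /= he.
  have [|d' d'w e'] := IHp x (drev d1) pp xA; first by rewrite dtail_rev.
  exists d' => //; rewrite e' phi_rev (negPf (nS0 _ _)) ?addbF ?d1v ?AW //.
  by apply: phi_tail; rewrite d1v ?AW ?dv.
have /connectP[p pp lp] : connect (step ends S') (corner j) (corner l).
  exact: joins_connect.
have [d' d'l phi'] := phi_path _ p (y j.+1) pp jA (dtail_iter j).
have : phi (y l.+1) = phi d'.
  by apply: phi_tail; rewrite dtail_iter ?AW // d'l.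
have Phi_y g : Phi (y g) = Phi d0 by elim: g => //= g <-; rewrite Phi_inv.
rewrite phi' /phi !Phi_y (@mem_arc i k j.+1); last lia.
(* For [l.+1 = n] the walk has returned to [d0], whose index 0 lies in no arc. *)
have -> : y l.+1 \in face_arc i k = false.
  have [ln|ln] := ltnP l.+1 n; first by rewrite mem_arc //; lia.
  have -> : l.+1 = n by lia.
  by rewrite (iter_order (@facemap_inj _ sigma)) (@mem_arc i k 0) ?order_gt0.
have -> : (i < j.+1 <= k)%N by lia.
by case: (Phi d0).
Qed.

End Corners.

Section Distance.
Variables (R : realFieldType) (len : E -> R).
Hypothesis len0 : forall e, 0 <= len e.

(** For nonnegative lengths, joins give the same minimum as paths and are closed under symmetric
    difference. The default, the total length, is never below the length of a join. *)
Definition dist a b : R :=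
  \big[Num.min/(\sum_e len e)]_(P : {set E} | joins ends P a b) wt len P.

Lemma wt_ge0 P : 0 <= wt len P.
Proof. by apply: sumr_ge0 => e _; exact: len0. Qed.

Lemma wt_symd_le P Q : wt len (symd P Q) <= wt len P + wt len Q.
Proof.
rewrite wt_symd lerD2l; apply: ler_sum => e _.
by case: ifP => // _; have := len0 e; lra.
Qed.

Lemma dist_le P a b : joins ends P a b -> dist a b <= wt len P.
Proof. by move=> jP; exact: (@bigmin_le_cond _ _ _ _ P (fun P => joins ends P a b) (wt len) jP). Qed.

Lemma dist_attained P a b : joins ends P a b ->
  exists2 Q, joins ends Q a b & dist a b = wt len Q.
Proof.
move=> jP; have [|Q jQ e] := @eq_bigmin _ _ _ (\sum_e len e) P (fun P => joins ends P a b) (wt len) jP; last by exists Q.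
move=> Q _; rewrite /wt big_mkcond; apply: ler_sum => e _; by case: ifP.
Qed.

Lemma dist_sym a b : dist a b = dist b a.
Proof. by apply: eq_bigl => P; rewrite joins_sym. Qed.

Lemma dist_ge0 a b : 0 <= dist a b.
Proof. by apply: le_bigmin => [|P _]; [exact: sumr_ge0 | exact: wt_ge0]. Qed.

Lemma dist_diag a : dist a a = 0.
Proof.
apply/eqP; rewrite eq_le dist_ge0 andbT; apply: le_trans (dist_le (joins0 ends a)) _.
by rewrite /wt big_set0.
Qed.

Lemma split_join S a b u : joins ends S a b -> connect (step ends S) a u ->
  exists P Q, [/\ joins ends P a u, joins ends Q u b & wt len P + wt len Q = wt len S].
Proof.
move=> jS /connect_joins[P PS jP]; exists P, (symd P S); split=> //.
  by apply: joins_symd jS; rewrite joins_sym.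
by rewrite symdC symd_sub // /wt [RHS](big_setID P) /= (setIidPr PS).
Qed.

(** Shortest joins of the two interlaced pairs meet at a vertex [u]; their halves at [u] recombine
    into joins for either of the other two pairings. *)
Lemma dist_interlaced d0 i j k l (n := fingraph.order fm d0) (c := corner d0) :
  (i <= j <= k)%N -> (k <= l < n)%N ->
  dist (c i) (c j) + dist (c k) (c l) <= dist (c i) (c k) + dist (c j) (c l) /\
  dist (c j) (c k) + dist (c i) (c l) <= dist (c i) (c k) + dist (c j) (c l).
Proof.
move=> ijk kln.
have [|S jS ->] := dist_attained (arc_joins (d0 := d0) (lo := i) (hi := k) _); first lia.
have [|S' jS' ->] := dist_attained (arc_joins (d0 := d0) (lo := j) (hi := l) _); first lia.
have [u uS uS'] := interlaced_meet ijk kln jS jS'.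
have [P [Q [jP jQ <-]]] := split_join jS uS.
have [P' [Q' [jP' jQ' <-]]] := split_join jS' uS'.
have j1 : joins ends (symd P P') (c i) (c j) by apply: joins_symd jP _; rewrite joins_sym.
have j2 : joins ends (symd Q Q') (c k) (c l) by apply: joins_symd jQ'; rewrite joins_sym.
have j3 : joins ends (symd P' Q) (c j) (c k) by apply: joins_symd jP' jQ.
have j4 : joins ends (symd P Q') (c i) (c l) by apply: joins_symd jP jQ'.
have := dist_le j1; have := dist_le j2; have := dist_le j3; have := dist_le j4.
have := wt_symd_le P P'; have := wt_symd_le Q Q'.
by have := wt_symd_le P' Q; have := wt_symd_le P Q'; lra.
Qed.

End Distance.

End FaceDistance.

(** * Noncrossing chords in faces *)

Section Laminar.
Variables (R : realFieldType) (V E : finType) (ends : E -> V * V) (sigma : {perm E * bool}).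
Hypothesis planar : planar_rotation ends sigma.

Local Notation dart := (E * bool)%type.
Local Notation fm := (facemap sigma).
Local Notation face := (face sigma).
Implicit Types (d : dart) (e : E).

Variables (m : nat) (A : 'I_m -> {set dart}) (rep : 'I_m -> dart) (s t : 'I_m -> V).
Hypothesis repA : forall k, rep k \in A k.
Hypothesis A_face : forall k d d', d \in A k -> d' \in A k -> face d = face d'.
Hypothesis A_laminar : forall i j : 'I_m, (i < j)%N -> (A j \subset A i) || [disjoint A j & A i].
Hypothesis A_boundary : forall k (X : {set V}),
  \big[addb/false]_(d in A k) crossing X (ends d.1) = (s k \in X) (+) (t k \in X).

Local Notation region := ({set dart} + 'I_m)%type.
Implicit Types (k : 'I_m) (U : {set region}).

(* The chord with arc A k joins the region reg k (rep k), in which it is drawn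
   after the chords of smaller index, to the new region inr k it cuts off. *)
Fixpoint reg (i : nat) d : region :=
  if i is i'.+1 then
    if insub i' is Some k then if d \in A k then inr k else reg i' d else reg i' d
  else inl (face d).

Lemma regS k d : reg k.+1 d = if d \in A k then inr k else reg k d.
Proof. by rewrite /= valK. Qed.

Lemma reg_const (i : nat) k d d' : (i <= k)%N -> d \in A k -> d' \in A k -> reg i d = reg i d'.
Proof.
move=> ik dk d'k; elim: i ik => [_|i IHi ik]; first by rewrite /= (A_face dk d'k).
have im : (i < m)%N by apply: ltn_trans ik (ltn_ord k).
have := regS (Ordinal im); rewrite /= => rS; rewrite !{}rS IHi; last exact: ltnW.
have [/subsetP sub|dis] := orP (@A_laminar (Ordinal im) k ik); first by rewrite !sub.
by rewrite !(disjointFr dis).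
Qed.

(** The region of [d] is reached from its face by passing in turn the chords whose arcs contain [d],
    and the changes of membership in [U] are added up. *)
Lemma reg_sum (i : nat) d U : (i <= m)%N ->
  (reg i d \in U) = (inl (face d) \in U) (+)
    \big[addb/false]_(k : 'I_m | (k < i)%N && (d \in A k)) ((inr k \in U) (+) (reg k (rep k) \in U)).
Proof.
elim: i => [_|i IHi im]; first by rewrite big_pred0 ?addbF.
pose k := Ordinal im; have := regS k d; rewrite /= => ->.
case: ifP => dk; last first.
  rewrite IHi; last exact: ltnW.
  congr addb; apply: eq_bigl => k'; have [e|ne] := eqVneq (val k') i.
    by rewrite (_ : k' = k) ?dk ?andbF //; exact/val_inj.
  by rewrite ltnS [(k' <= i)%N]leq_eqVlt (negPf ne).
rewrite (bigD1 k) /=; last by rewrite ltnS leqnn.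
rewrite (reg_const (i := k) (k := k) _ (repA k) dk) //= IHi; last exact: ltnW.
rewrite [X in _ = _ (+) (_ (+) X)](_ : _ = \big[addb/false]_(k' : 'I_m | (k' < i)%N && (d \in A k'))
   ((inr k' \in U) (+) (reg k' (rep k') \in U))).
  by case: (_ \in U); case: (_ \in U); case: (\big[_/_]_(_ | _) _).
apply: eq_bigl => k'; have [->|ne] := eqVneq k' k; first by rewrite /= ltnn andbF.
have ne' : val k' != i by apply: contra ne => /eqP e; apply/eqP/val_inj.
by rewrite andbT ltnS leq_eqVlt (negPf ne').
Qed.

Definition chord_ends (x : E + 'I_m) : region * region :=
  match x with
  | inl e => (reg m (e, false), reg m (e, true))
  | inr k => (inr k, reg k (rep k))
  end.

Lemma big_sum_bool (F : E + 'I_m -> bool) : \big[addb/false]_x F x =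
  \big[addb/false]_e F (inl e) (+) \big[addb/false]_k F (inr k).
Proof. exact: big_sumType. Qed.

Lemma face_potential (F : {set dart}) :
  exists U, (forall d, (reg m d \in U) = (face d == F)) /\
    forall k, crossing U (chord_ends (inr k)) = false.
Proof.
pose U : {set region} := [set x | match x with inl F' => F' == F | inr k => face (rep k) == F end].
have regU i d : (reg i d \in U) = (face d == F).
  elim: i => [|i IHi]; first by rewrite inE.
  rewrite /=; case: insubP => [k _ _|_] //; case: ifP => // dk.
  by rewrite inE (A_face (repA k) dk).
exists U; split=> [d|k]; first exact: regU.
by rewrite crossingE /= regU inE addbb.
Qed.

(** [U] is the side of the chord [k] at its arc: the region it cuts off and those cut off later from
    within the arc. *)
Lemma chord_potential k :
  exists U, (forall d, (reg m d \in U) = (d \in A k)) /\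
    forall j, crossing U (chord_ends (inr j)) = (j == k).
Proof.
pose U : {set region} := [set x | match x with
  | inl _ => false | inr j => (j == k) || ((k < j)%N && (rep j \in A k)) end].
have regU i d : (reg i d \in U) = (k < i)%N && (d \in A k).
  elim: i => [|i IHi]; first by rewrite inE.
  rewrite /=; case: insubP => [j jm ji|im]; last first.
    by rewrite IHi; move: (ltn_ord k) im; rewrite -leqNgt ltnS;
       case: (_ \in _); rewrite ?andbF ?andbT //; lia.
  subst i; rewrite ltnS leq_eqVlt; case: ifP => dj.
    rewrite inE [k == j :> nat]eq_sym -(inj_eq val_inj) /=.
    have [e|ne] /= := eqVneq (val j) (val k).
      by rewrite (_ : k = j) ?dj //; apply/val_inj.
    have [kj|] //= := boolP (k < j)%N.
    have [/subsetP sub|dis] := orP (A_laminar kj); first by rewrite !sub.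
    by rewrite !(disjointFr dis).
  rewrite IHi [k == j :> nat]eq_sym; have [e|ne] //= := eqVneq (val j) (val k).
  by rewrite (_ : k = j) ?dj ?andbF //; apply/val_inj.
exists U; split=> [d|j]; first by rewrite regU ltn_ord.
rewrite crossingE /= regU inE; case: (j == k) / eqP => [->|_] /=; first by rewrite ltnn.
by rewrite addbb.
Qed.

Variables (c len : E -> R) (w dst : 'I_m -> R).
Hypothesis c0 : forall e : E, 0 <= c e.
Hypothesis w0 : forall k, 0 <= w k.
Hypothesis len0 : forall e : E, 0 <= len e.
Hypothesis w_cut : forall X : {set V},
  \sum_(k | crossing X (s k, t k)) w k <= \sum_(e | crossing X (ends e)) c e.
Hypothesis dst_le : forall k (S : {set E}), joins ends S (s k) (t k) -> dst k <= wt len S.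

Let wgt (x : E + 'I_m) : R := match x with inl e => c e | inr k => w k end.
Let J : {set E + 'I_m} := [set x | if x is inr _ then true else false].

Let wtJ' (J' : {set E + 'I_m}) :
  wt wgt J' = \sum_(e | inl e \in J') c e + \sum_(k | inr k \in J') w k.
Proof. by rewrite /wt big_sumType. Qed.

Let wtJ : wt wgt J = \sum_k w k.
Proof.
rewrite wtJ' big_pred0 ?add0r; last by move=> e; rewrite inE.
by apply: eq_bigl => k; rewrite inE.
Qed.

Let parE (J' : {set E + 'I_m}) U : par chord_ends J' U =
  \big[addb/false]_e ((inl e \in J') && ((reg m (e, false) \in U) (+) (reg m (e, true) \in U))) (+)
  \big[addb/false]_k ((inr k \in J') && crossing U (chord_ends (inr k))).
Proof.
rewrite /par big_sum_bool; congr addb; apply: eq_bigr => e _.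
by rewrite crossingE.
Qed.

Let parJ U : par chord_ends J U = \big[addb/false]_k crossing U (chord_ends (inr k)).
Proof.
rewrite parE big1 ?addFb; last by move=> e _; rewrite inE.
by apply: eq_bigr => k _; rewrite inE.
Qed.

(** The edges of [J'] meet every face evenly, so they form a cut [X]; testing with the side of each
    chord shows that the chords missing from [J'] are those separated by [X]. The claim is then the
    cut condition for [X]. *)
Let J_min (J' : {set E + 'I_m}) : sim chord_ends J J' -> wt wgt J <= wt wgt J'.
Proof.
move/simP => simJ; pose Z := [set e | inl e \in J'].
have [|X ZX] := dual_even_cut planar (Z := Z).
  move=> F FF; have [U [regU chU]] := face_potential F.
  have := simJ U; rewrite parJ parE [X in _ (+) X]big1 ?addbF; last by move=> k _; rewrite chU andbF.
  rewrite [X in _ = X]big1; last by move=> k _; exact: chU.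
  apply: etrans; apply: eq_bigr => e _.
  by rewrite inE !regU /chain !(faceE _ FF).
have sep k : (inr k \notin J') = crossing X (s k, t k).
  have [U [regU chU]] := chord_potential k.
  have := simJ U; rewrite parJ parE.
  have pick (f : 'I_m -> bool) :
      \big[addb/false]_j (f j && crossing U (chord_ends (inr j))) = f k.
    rewrite (bigD1 k) // chU eqxx andbT big1 => [|j /negPf jk]; first exact: addbF.
    by rewrite chU jk andbF.
  rewrite (pick (fun j => inr j \in J')) (pick xpredT).
  rewrite crossingE /= -(A_boundary k X) -(chain_sum (fun e => crossing X (ends e))).
  rewrite (eq_bigr (fun e => crossing X (ends e) && chain (A k) e)); last first.
    by move=> e _; rewrite !regU -ZX inE.
  by case: (inr k \in J'); case: (\big[_/_]_e _).
rewrite wtJ wtJ' [X in X <= _](bigID (fun k => inr k \in J')) /= addrC lerD2r.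
rewrite (eq_bigl _ _ sep); apply: le_trans (w_cut X) _.
by rewrite [X in _ <= X](eq_bigl (fun e => crossing X (ends e))) // => e; rewrite -ZX inE.
Qed.

(** Each packed cut contains an odd number of chords, and the packing has the total weight of all
    chords as its value. Counting forces exactly one chord in each packed cut and saturates every
    chord; the edges of such a cut join the ends of its chord [k], so their length is at least
    [dst k]. *)
Lemma laminar_le : \sum_k w k * dst k <= \sum_e c e * len e.
Proof.
have wgt0 x : 0 <= wgt x by case: x.
have [y [y0 yodd ywgt ysum]] := tjoin_packing wgt0 J_min.
pose cut U := [set k | crossing U (chord_ends (inr k))].
have odd_cut U : y U != 0 -> odd #|cut U|.
  move/yodd; rewrite parJ -sum1_card (big_morph odd oddD (erefl _)) [in X in _ -> X]big_mkcond /=.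
  by rewrite (eq_bigr (fun k => if k \in cut U then true else false)) // => k _; rewrite inE; case: ifP.
have sumk : \sum_k \sum_(U | crossing U (chord_ends (inr k))) y U = \sum_U y U *+ #|cut U|.
  rewrite (exchange_big_dep predT) //=; apply: eq_bigr => U _.
  by rewrite sumr_const; congr (_ *+ _); apply: eq_card => k; rewrite inE.
have le_k k : \sum_(U | crossing U (chord_ends (inr k))) y U <= w k := ywgt (inr k).
have cut1 U : y U <= y U *+ #|cut U|.
  have [->|/odd_cut] := eqVneq (y U) 0; first by rewrite mul0rn.
  case: #|cut U| => // n _; rewrite mulrS lerDl mulrn_wge0 //.
have sum_eq : \sum_k \sum_(U | crossing U (chord_ends (inr k))) y U = \sum_k w k.
  apply/eqP; rewrite eq_le; apply/andP; split; first by apply: ler_sum.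
  by rewrite -wtJ -ysum sumk; apply: ler_sum.
have tight k : \sum_(U | crossing U (chord_ends (inr k))) y U = w k.
  apply/eqP; rewrite eq_le le_k -subr_le0.
  have : \sum_k (w k - \sum_(U | crossing U (chord_ends (inr k))) y U) = 0.
    by rewrite sumrB sum_eq subrr.
  rewrite (bigD1 k) //= => /eqP; rewrite addr_eq0 => /eqP ->.
  by rewrite oppr_le0 sumr_ge0 // => j _; rewrite subr_ge0; exact: le_k.
have card1 U : y U != 0 -> #|cut U| = 1%N.
  move=> yU; apply/eqP; have : \sum_U (y U *+ #|cut U| - y U) = 0.
    by rewrite sumrB -sumk sum_eq ysum wtJ subrr.
  move/eqP; rewrite psumr_eq0 => [/allP/(_ U)|W _]; last by rewrite subr_ge0.
  rewrite mem_index_enum => /(_ isT); rewrite subr_eq0.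
  case: #|cut U| (odd_cut _ yU) => // n _ /=; rewrite mulrS -subr_eq0 addrAC subrr add0r.
  by rewrite mulrn_eq0 (negPf yU) orbF => /eqP ->.
under eq_bigr do rewrite -tight mulr_suml.
rewrite (exchange_big_dep predT) //=.
pose S U := [set e | crossing U (chord_ends (inl e))].
apply: (@le_trans _ _ (\sum_U y U * wt len (S U))).
  apply: ler_sum => U _; have [->|yU] := eqVneq (y U) 0.
    by rewrite mul0r big1 // => k _; rewrite mul0r.
  have /eqP/cards1P[k cutk] := card1 U yU.
  have kU j : crossing U (chord_ends (inr j)) = (j == k).
    by have /setP/(_ j) := cutk; rewrite !inE.
  rewrite (eq_bigl _ _ kU) big_pred1_eq ler_wpM2l //; apply: dst_le; apply/joins_parP => X.
  pose phi d := inl (face d) \in U.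
  have inv d : phi (fm d) = phi d by rewrite /phi face_facemap.
  (* As [k] is the only chord crossing [U], membership of regions in [U] differs from that of their
     faces precisely along the arc of [k]. So the edges crossing [U] are the arc plus a boundary of
     faces. *)
  have regE d : (reg m d \in U) = phi d (+) (d \in A k).
    rewrite reg_sum // -/(phi d); congr addb.
    have [dk|dk] := boolP (d \in A k).
      rewrite (bigD1 k) ?ltn_ord //= big1 ?addbF => [|j /andP[_ /negPf jk]].
        by have := kU k; rewrite crossingE eqxx.
      by have := kU j; rewrite crossingE jk.
    rewrite big1 // => j /andP[_ jd]; have := kU j; rewrite crossingE => ->.
    by apply/eqP => jk; rewrite jk (negPf dk) in jd.
  rewrite -(A_boundary k X) -(chain_sum (fun e => crossing X (ends e))).
  have := facemap_inv_even planar X inv => even0.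
  rewrite -[RHS]addFb -{1}even0 -big_split; apply: eq_bigr => e _ /=.
  rewrite inE crossingE /= !regE /chain.
  by case: (crossing X _); case: (phi _); case: (phi _); case: (_ \in A k); case: (_ \in A k).
rewrite (eq_bigr (fun U => \sum_(e in S U) y U * len e)); last first.
  by move=> U _; rewrite mulr_sumr.
rewrite (exchange_big_dep predT) //=; apply: ler_sum => e _.
rewrite -mulr_suml ler_wpM2r //; apply: le_trans (ywgt (inl e)).
by rewrite (eq_bigl (fun U => crossing U (chord_ends (inl e)))) // => U; rewrite inE.
Qed.

End Laminar.

(** * Linear programming duality for multiflows *)

Section Farkas.
Variables (R : realFieldType) (K : finType) (I : eqType).

Definition dot (a x : K -> R) := \sum_k a k * x k.

Lemma dot_combl (a b : K -> R) c x : dot (fun k => a k - c * b k) x = dot a x - c * dot b x.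
Proof. by rewrite /dot mulr_sumr -sumrB; apply: eq_bigr => k _; ring. Qed.

Lemma dot_combr (a x z : K -> R) c : dot a (fun k => x k - c * z k) = dot a x - c * dot a z.
Proof. by rewrite /dot mulr_sumr -sumrB; apply: eq_bigr => k _; ring. Qed.

(* Bartl's induction: a point x violating the implication for all functionals
   but A i is projected along x onto the kernel of A i. *)
Lemma farkas (s : seq I) (A : I -> K -> R) (g : K -> R) : uniq s ->
  (exists y : I -> R, (forall j, 0 <= y j) /\ forall k, g k = \sum_(j <- s) y j * A j k) \/
  (exists x : K -> R, (forall j, j \in s -> dot (A j) x <= 0) /\ 0 < dot g x).
Proof.
elim: s A g => [|i s IHs] A g /=.
  move=> _; have [g0|/existsP[k gk]] := boolP [forall k, g k == 0].
    left; exists (fun=> 0); split=> // k; rewrite big_nil; exact/eqP/(forallP g0).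

  right; exists g; split=> //; rewrite /dot (bigD1 k) //= ltr_pwDl //.
    by rewrite -expr2 exprn_even_gt0.
  by apply: sumr_ge0 => j _; rewrite -expr2 sqr_ge0.
case/andP => is_ us; have cons_y (y : I -> R) (b : R) : 0 <= b -> (forall j, 0 <= y j) ->
    (forall k, g k = b * A i k + \sum_(j <- s) y j * A j k) ->
    exists y : I -> R, (forall j, 0 <= y j) /\
      forall k, g k = \sum_(j <- i :: s) y j * A j k.
  move=> b0 y0 gE; exists (fun j => if j == i then b else y j); split=> [j|k].
    by case: ifP.
  rewrite big_cons eqxx gE; congr (_ + _); rewrite !big_seq; apply: eq_bigr => j js.
  by case: eqP => // ji; rewrite -ji js in is_.
have [[y [y0 gE]]|[x [Ax gx]]] := IHs A g us.
  by left; apply: (cons_y y 0) => // k; rewrite mul0r add0r.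
have [Aix|Aix] := leP (dot (A i) x) 0.
  by right; exists x; split=> // j; rewrite inE => /orP[/eqP ->|/Ax].
set al := dot (A i) x in Aix.
pose A' j k := A j k - (dot (A j) x / al) * A i k.
pose g' k := g k - (dot g x / al) * A i k.
have [[y [y0 gE]]|[z [Az gz]]] := IHs A' g' us.
  left; apply: (cons_y y ((dot g x - \sum_(j <- s) y j * dot (A j) x) / al)) => //.
    rewrite divr_ge0 ?(ltW Aix) // subr_ge0; apply: le_trans (ltW gx).
    rewrite -oppr_ge0 -sumrN big_seq sumr_ge0 // => j js.
    by rewrite -mulrN mulr_ge0 // oppr_ge0 Ax.
  move=> k; have := gE k; rewrite /g' => /eqP; rewrite subr_eq => /eqP ->.
  rewrite /A' (eq_bigr (fun j => y j * A j k - y j * dot (A j) x * (A i k / al))); last first.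
    by move=> j _; ring.
  rewrite sumrB -mulr_suml; ring.
right; exists (fun k => z k - (dot (A i) z / al) * x k).
have alK : al / al = 1 by rewrite divff // gt_eqF.
split=> [j|]; rewrite dot_combr.
  rewrite inE => /orP[/eqP ->|/Az]; first by rewrite -/al divfK ?subrr // gt_eqF.
  by rewrite dot_combl; set p := dot _ _; set q := dot _ _; set t := dot _ _; lra.
by move: gz; rewrite dot_combl; set p := dot _ _; set q := dot _ _; set t := dot _ _; lra.
Qed.

End Farkas.

Section Routing.
Variables (R : realFieldType) (V E D : finType).
Variables (ends : E -> V * V) (dem : D -> V * V) (c : E -> R) (r : D -> R) (lam : R).
Local Notation dart := (E * bool)%type.
Implicit Types (p : seq dart) (len : E -> R).

Definition uses p e := count (fun d : dart => d.1 == e) p.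

Definition path_len len p := \sum_e len e *+ uses p e.

Lemma stpath_size s t p : stpath ends s t p -> (size p <= #|V|)%N.
Proof.
case/andP => _ /card_uniqP /=; rewrite size_map => e.
by apply: ltnW; rewrite -e max_card.
Qed.

(** Farkas' alternative for the system with one variable per simple path, of bounded length to keep
    them finite in number, and one slack per edge: a solution is a routing, and otherwise the
    certificate provides [u] and [len] violating the hypothesis. *)
Lemma routable_dual :
  (forall (u : D -> R) len, (forall e, 0 <= len e) ->
     (forall h p, stpath ends (dem h).1 (dem h).2 p -> u h <= path_len len p) ->
     \sum_h r h * u h <= lam * \sum_e c e * len e) ->
  routable ends dem c r lam.
Proof.
move=> dual.
pose I : finType := (D * (#|V|).-bseq dart + E)%type.
pose ok (i : I) := if i is inl (h, p) then stpath ends (dem h).1 (dem h).2 p else true.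
pose A (i : I) (k : D + E) : R := match i, k with
  | inl (h, p), inl h' => (h' == h)%:R
  | inl (h, p), inr e => - (uses p e)%:R
  | inr e, inl h => 0
  | inr e, inr e' => - (e' == e)%:R end.
pose g (k : D + E) : R := match k with inl h => r h | inr e => - (lam * c e) end.
have sumI (F : I -> R) : \sum_(i <- enum ok) F i =
    \sum_h \sum_(p : (#|V|).-bseq dart | stpath ends (dem h).1 (dem h).2 p) F (inl (h, p)) +
    \sum_e F (inr e).
  rewrite big_enum big_sumType /= pair_big_dep /=; congr (_ + _).
  by apply: eq_big => [[h p]|[h p] _].
have [[y [y0 gE]]|[x [Ax gx]]] := farkas A g (enum_uniq ok).
  pose paths h := enum [pred b : (#|V|).-bseq dart | stpath ends (dem h).1 (dem h).2 b].
  exists (fun h => [seq (val b, y (inl (h, b))) | b <- paths h]).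
  split; [|split].
  - move=> h; apply/allP => _ /mapP[p + ->]; rewrite mem_enum inE /= => -> /=.
    exact: y0.
  - move=> h; rewrite big_map big_enum /=; have := gE (inl h); rewrite sumI /= => ->.
    rewrite [X in _ + X]big1 ?addr0; last by move=> e _; rewrite mulr0.
    rewrite (bigD1 h) //= [X in _ + X]big1 ?addr0; last first.
      move=> h' /negPf hh'; apply: big1 => p _; by rewrite eq_sym hh' mulr0.
    by apply: eq_big => [p|p _]; rewrite ?inE // eqxx mulr1.
  move=> e; have := gE (inr e); rewrite sumI /=.
  rewrite (bigD1 e) //= eqxx [X in _ + (_ + X)]big1 ?addr0; last first.
    by move=> e' /negPf ee'; rewrite eq_sym ee' oppr0 mulr0.
  pose S := \sum_h \sum_(pw <- [seq (val b, y (inl (h, b))) | b <- paths h]) load pw.1 pw.2 e.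
  have -> : \sum_h \sum_(p : (#|V|).-bseq dart | stpath ends (dem h).1 (dem h).2 p)
      y (inl (h, p)) * - (uses p e)%:R = - S.
    rewrite -sumrN; apply: eq_bigr => h _; rewrite big_map big_enum -sumrN /=.
    by apply: eq_big => [p|p _]; rewrite ?inE // mulrN mulr_natr.
  rewrite mulr1n mulrN1 => gS; have ye := y0 (inr e); suff : S <= lam * c e by [].
  lra.
exfalso; have := dual (fun h => x (inl h)) (fun e => x (inr e)).
have le_x i : ok i -> dot (A i) x <= 0 by move=> oki; apply: Ax; rewrite mem_enum.
have dotE (a : D + E -> R) : dot a x = \sum_h a (inl h) * x (inl h) + \sum_e a (inr e) * x (inr e).
  by rewrite /dot big_sumType.
move: gx; rewrite dotE /= => gx; move=> W.
have : \sum_h r h * x (inl h) <= lam * \sum_e c e * x (inr e).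
  apply: W => [e|h p hp].
    have := le_x (inr e) isT; rewrite dotE /= big1 ?add0r; last by move=> *; rewrite mul0r.
    rewrite (bigD1 e) //= eqxx mulN1r big1 ?addr0 ?oppr_le0 // => e' /negPf ->.
    by rewrite oppr0 mul0r.
  have := le_x (inl (h, Bseq (stpath_size hp))) hp; rewrite dotE /=.
  rewrite (bigD1 h) //= eqxx mul1r big1 ?addr0; last by move=> h' /negPf ->; rewrite mul0r.
  rewrite (_ : \sum_e _ = - path_len (fun e => x (inr e)) p) ?subr_le0 //.
  by rewrite -sumrN; apply: eq_bigr => e _; rewrite mulNr mulrC mulr_natr.
rewrite mulr_sumr; move: gx; rewrite (eq_bigr (fun e => - (lam * (c e * x (inr e))))).
  by rewrite sumrN; lra.
by move=> e _; rewrite mulNr mulrA.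
Qed.

Lemma stpath_uniq_edges s t p : stpath ends s t p -> uniq (map fst p).
Proof.
rewrite /stpath; elim: p s => //= d p IHp s /andP[/andP[/eqP ds wp]].
rewrite inE negb_or => /andP[/andP[_ sp] /andP[dp up]].
rewrite (IHp (dhead ends d)) ?andbT; last by rewrite wp /= dp.
apply/negP => /mapP[d' d'p e]; have [d'd|d'd] := eqVneq d' d.
  by case/negP: dp; apply/mapP; exists d'; rewrite ?d'd // -d'd.
case/negP: sp; apply/mapP; exists d' => //; rewrite -ds.
case: d d' {IHp ds wp dp up d'p} e d'd => [f b] [f' b'] /= ->.
by rewrite xpair_eqE eqxx /dhead /dtail /=; case: b; case: b'.
Qed.

Lemma joins_stpath (Q : {set E}) len s t : (forall e, 0 <= len e) -> joins ends Q s t ->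
  exists2 p, stpath ends s t p & path_len len p <= wt len Q.
Proof.
move=> len0 /joins_connect/connectP[q0 q0p ->].
case: (shortenP q0p) => q qp qu _ {q0 q0p}.
have [p [wp mp pQ]] : exists p, [/\ walk ends s p (last s q), map (dhead ends) p = q &
    all (fun d => d.1 \in Q) p].
  elim: q s qp {qu} => [|v q IHq] s /=; first by move=> _; exists [::]; rewrite /= eqxx.
  case/andP => /existsP[e /andP[eQ sv]] /IHq[p [wp mp pQ]].
  have [d [d1 dt dh]] : exists d : dart, [/\ d.1 = e, dtail ends d = s & dhead ends d = v].
    by case/orP: sv => /eqP he; [exists (e, false) | exists (e, true)];
      rewrite /dtail /dhead /= he.
  by exists (d :: p); rewrite /= dt dh eqxx wp mp d1 eQ.
have st : stpath ends s (last s q) p by rewrite /stpath wp mp.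
exists p => //; rewrite /path_len.
have -> : \sum_e len e *+ uses p e = \sum_(e <- map fst p) len e.
  rewrite big_map; elim: (p) => [|d p' IHp']; first by rewrite big_nil big1.
  rewrite big_cons -IHp'; under eq_bigr do rewrite /uses /= mulrnDr.
  rewrite big_split (bigD1 d.1) //= eqxx big1 ?addr0 // => e /negPf.
  by rewrite eq_sym => ->.
rewrite big_uniq ?(stpath_uniq_edges st) //= /wt big_mkcond [X in _ <= X]big_mkcond.
apply: ler_sum => e _; case: ifP => [/mapP[d dp ->]|_]; last by case: ifP.
by rewrite (allP pQ).
Qed.

End Routing.

(** * The congestion bound *)

Section FaceCover.
Variables (R : realFieldType) (V E D : finType).
Variables (ends : E -> V * V) (sigma : {perm E * bool}) (dem : D -> V * V).
Hypothesis planar : planar_rotation ends sigma.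
Variables (r : D -> R) (len : E -> R).
Hypothesis r0 : forall h, 0 <= r h.
Hypothesis len0 : forall e, 0 <= len e.

Local Notation dart := (E * bool)%type.
Local Notation fm := (facemap sigma).
Local Notation dtail := (dtail ends).
Local Notation dhead := (dhead ends).
Local Notation face := (face sigma).
Local Notation dist := (dist ends len).
Implicit Types (d : dart) (X : {set V}) (C : nat * nat * R).

Variable d0 : dart.
Local Notation n := (fingraph.order fm d0).
Local Notation y g := (iter g fm d0).
Local Notation corner := (corner ends sigma d0).

Definition chord_sep X C := crossing X (corner C.1.1, corner C.1.2).
Definition chord_dist C := dist (corner C.1.1) (corner C.1.2).

Lemma crossing_face_even X :
  ~~ odd #|[set d in face d0 | crossing X (ends d.1)]|.
Proof.
have inv d : (fm d \in face d0) = (d \in face d0).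
  by rewrite !(faceE _ (face_in _ _)) face_facemap.
have -> : odd #|[set d in face d0 | crossing X (ends d.1)]| =
    \big[addb/false]_(d in face d0) crossing X (ends d.1).
  rewrite -sum1_card (big_morph odd oddD (erefl _)) big_mkcond [RHS]big_mkcond.
  by apply: eq_bigr => d _; rewrite inE; case: (d \in face d0); case: (crossing _ _).
rewrite -(chain_sum (fun e => crossing X (ends e))); apply/negbT.
exact: (facemap_inv_even planar (phi := fun d => d \in face d0) X inv).
Qed.

(** A cut meeting the boundary walk in two darts acts on the corners as the split at these two gaps;
    by parity the only other case is no crossing. *)
Lemma two_crossings X : (#|[set d in face d0 | crossing X (ends d.1)]| <= 2)%N ->
  (forall lo hi, (lo <= hi < n)%N -> crossing X (corner lo, corner hi) = false) \/
  exists g g', (g <= g')%N /\ forall lo hi, (lo <= hi < n)%N ->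
    crossing X (corner lo, corner hi) = (lo < g <= hi)%N (+) (lo < g' <= hi)%N.
Proof.
set Y := [set _ in _ | _] => Y2.
have sepE lo hi : (lo <= hi < n)%N ->
    crossing X (corner lo, corner hi) = \big[addb/false]_(d in Y) (d \in face_arc sigma d0 lo hi).
  move=> h; rewrite crossingE /= -(arc_boundary planar X h) big_mkcond [RHS]big_mkcond.
  apply: eq_bigr => d _; rewrite [d \in Y]inE.
  have [da|] := boolP (d \in face_arc _ _ _ _); last by case: ifP.
  by move: (da); rewrite inE => /andP[-> _] /=; case: (crossing _ _).
have [Y0|/set0Pn[d dY]] := eqVneq Y set0.
  by left=> lo hi h; rewrite sepE // Y0 big_set0.
right; have cY : #|Y| = 2%N.
  have := crossing_face_even X; rewrite -/Y; move: Y2; have : (0 < #|Y|)%N by apply/card_gt0P; exists d.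
  by case: #|Y| => [|[|[|]]].
have := cY; rewrite (cardsD1 d) dY => -[/eqP/cards1P[d' Yd']].
have d'd : d' != d by have := set11 d'; rewrite -Yd' !inE => /andP[].
have YE : Y = [set d; d'] by rewrite -Yd' setD1K.
have inF x : x \in Y -> x \in face d0 by rewrite inE => /andP[].
have [g gn dg] := face_iter (inF _ dY).
have [|g' g'n dg'] := face_iter (inF d' _); first by rewrite YE !inE eqxx orbT.
have E2 lo hi : (lo <= hi < n)%N -> crossing X (corner lo, corner hi) =
    (lo < g <= hi)%N (+) (lo < g' <= hi)%N.
  move=> h; rewrite sepE // YE big_setU1 ?in_set1 1?eq_sym //= big_set1.
  by rewrite dg dg' !mem_arc.
have [gg'|g'g] := leqP g g'; first by exists g, g'.
by exists g', g; split; [exact: ltnW | move=> lo hi h; rewrite E2 // addbC].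
Qed.

(** A vertex may occur at several corners of the face; its first one is chosen, so that each
    terminal is marked only once. *)
Definition corner_index v := find (fun g => corner g == v) (iota 0 n).

Lemma corner_indexP v : v \in [set dtail d | d in face d0] ->
  (corner_index v < n)%N /\ corner (corner_index v) = v.
Proof.
case/imsetP => d dF ->.
have hasc : has (fun g => corner g == dtail d) (iota 0 n).
  have [g gn dg] := face_iter dF; apply/hasP.
  have [g0|[g' e]] : g = 0%N \/ exists g', g = g'.+1 by case: (g) => [|g']; [left | right; exists g'].
    exists n.-1; first by rewrite mem_iota /= prednK ?order_gt0 // ltnS.
    rewrite dg g0 /= -[X in _ == dtail X](iter_order (@facemap_inj _ sigma)) -[X in iter X]prednK ?order_gt0 //.
    by rewrite iterS (dtail_facemap planar).
  exists g'; first by rewrite mem_iota /= -e ltnW // e.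
  by rewrite dg e iterS (dtail_facemap planar).
split; first by rewrite /corner_index -[X in (_ < X)%N](size_iota 0) -has_find.
have := nth_find 0%N hasc; rewrite nth_iota ?add0n => [/eqP //|].
by rewrite -[X in (_ < X)%N](size_iota 0) -has_find.
Qed.

Variables (L : nat) (P : pred D).
Hypothesis P_face : forall h, P h ->
  ((dem h).1 \in [set dtail d | d in face d0]) && ((dem h).2 \in [set dtail d | d in face d0]).
Hypothesis few_terminals :
  (#|[set v in [set dtail d | d in face d0] | terminal dem v]| <= 2 ^ L)%N.

Let lo h := minn (corner_index (dem h).1) (corner_index (dem h).2).
Let hi h := maxn (corner_index (dem h).1) (corner_index (dem h).2).
Let marked g := (corner_index (corner g) == g) && terminal dem (corner g).

Let lohi h : P h -> [&& (0 <= lo h)%N, (lo h <= hi h)%N, (hi h < n)%N, marked (lo h) & marked (hi h)].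
Proof.
move=> /P_face/andP[/corner_indexP[n1 c1] /corner_indexP[n2 c2]].
have m1 : marked (corner_index (dem h).1).
  by rewrite /marked c1 eqxx; apply/existsP; exists h; rewrite eqxx.
have m2 : marked (corner_index (dem h).2).
  by rewrite /marked c2 eqxx; apply/existsP; exists h; rewrite eqxx orbT.
by rewrite /lo /hi; case: (leqP (corner_index (dem h).1) (corner_index (dem h).2)) => h12; apply/and5P; split=> //; exact: ltnW.
Qed.

Let dem_chord h : P h -> (forall X, crossing X (dem h) = crossing X (corner (lo h), corner (hi h))) /\
  dist (dem h).1 (dem h).2 = dist (corner (lo h)) (corner (hi h)).
Proof.
move=> /P_face/andP[/corner_indexP[n1 c1] /corner_indexP[n2 c2]].
rewrite /lo /hi; case: (leqP (corner_index (dem h).1) (corner_index (dem h).2)) => _; rewrite c1 c2.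
  by split=> // X; rewrite -surjective_pairing.
by rewrite dist_sym; split=> // X; rewrite !crossingE addbC.
Qed.

Let few_marked : (\sum_(0 <= g < n) marked g <= 2 ^ L)%N.
Proof.
apply: leq_trans few_terminals; rewrite cardE.
have -> : (\sum_(0 <= g < n) marked g = size [seq corner g | g <- iota 0 n & marked g])%N.
  rewrite size_map size_filter -sum1_count [RHS]big_mkcond /index_iota subn0.
  by apply: eq_bigr => g _; case: (marked g).
apply: uniq_leq_size.
  rewrite map_inj_in_uniq ?filter_uniq ?iota_uniq // => g g'.
  rewrite !mem_filter => /andP[/andP[/eqP e _] _] /andP[/andP[/eqP e' _] _] c.
  by rewrite -e -e' c.
move=> v /mapP[g]; rewrite mem_filter mem_iota => /andP[/andP[_ tg] _] ->.
rewrite mem_enum inE tg andbT -(dtail_iter planar); apply/imsetP.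
by exists (y g.+1) => //; rewrite inE fconnect_iter.
Qed.

(** Laminar chords realize each contour of [contour_cover]. A cut crossing the boundary at most
    twice acts as a single split, where contours are dominated; since [dist] is a nonnegative
    combination of splits, the covering of splits passes to weighted distances. *)
Lemma face_cover : exists S : 'I_(L + L.+1) -> seq (nat * nat * R),
  [/\ forall i, all (chord_ok n) (S i), forall i, pairwise (@laminar R) (S i),
    forall i X, (#|[set d in face d0 | crossing X (ends d.1)]| <= 2)%N ->
      \sum_(C <- S i) C.2 *+ chord_sep X C <= \sum_(h | P h) r h *+ crossing X (dem h) &
    \sum_(h | P h) r h * dist (dem h).1 (dem h).2 <=
      \sum_i \sum_(C <- S i) C.2 * chord_dist C].
Proof.
have [M [B [cM cB cov]]] := contour_cover r0 (leq0n n) few_marked lohi.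
pose f i := if (i < L)%N then M i else B (i - L)%N.
have cf i : contour lo hi r 0 n P (f i) by rewrite /f; case: ifP.
have /fin_all_exists[S SP] (i : 'I_(L + L.+1)) : exists s, [/\ all (chord_ok n) s,
    pairwise (@laminar R) s,
    forall g g', (g <= g')%N -> tdist (f i) g g' <= chords_dist s g g' &
    forall g g', (g <= g')%N -> chords_dist s g g' <= delta lo hi r P g g'].
  have [f0 fout fdom] := cf i; have [s [ok lam ge le]] := contour_chords f0 fout.
  exists s; split=> // g g' gg'; have [z hz le_z] := le g g' gg'.
  exact: le_trans le_z (fdom _ _ _ hz).
have okS i C : C \in S i -> (C.1.1 <= C.1.2 < n)%N.
  by have [/allP ok _ _ _] := SP i; move/ok/and3P => [h1 h2 _]; rewrite h2 ltnW.
exists S; split=> [i|i|i X X2|].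
- by have [] := SP i.
- by have [] := SP i.
- have demE h : P h -> crossing X (dem h) = crossing X (corner (lo h), corner (hi h)).
    by move=> Ph; have [->] := dem_chord Ph.
  have lohi' h : P h -> (lo h <= hi h < n)%N by move/lohi/and5P => [_ -> ->].
  have [none|[g [g' [gg' two]]]] := two_crossings X2.
    rewrite big_seq big1; last by move=> C /okS h; rewrite /chord_sep none.
    by apply: sumr_ge0 => h _; rewrite mulrn_wge0.
  have [_ _ _ /(_ g g' gg')] := SP i; rewrite /chords_dist /delta.
  congr (_ <= _); first by rewrite big_seq [RHS]big_seq; apply: eq_bigr => C /okS h; rewrite /chord_sep two.
  by apply: eq_bigr => h Ph; rewrite demE // two // lohi'.
pose dd i j := dist (corner i) (corner j).
have cut := @kalmanson_cuts R n dd (fun i j => dist_sym ends len _ _)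
  (fun i => dist_diag ends len0 _).
have d_cross i j k l : (i <= j <= k)%N -> (k <= l < n)%N ->
  dd i j + dd k l <= dd i k + dd j l /\ dd j k + dd i l <= dd i k + dd j l.
  exact: (dist_interlaced planar len0 (d0 := d0)).
have sw0 := @split_wt_ge0 R n dd (fun i j => dist_sym ends len _ _) d_cross.
pose Q (del : nat -> nat -> R) := \sum_(g < n) \sum_(g' < n) split_wt n dd g g' * del g g'.
have QP : 4 * (\sum_(h | P h) r h * dist (dem h).1 (dem h).2) = Q (delta lo hi r P).
  rewrite /Q /delta; under [RHS]eq_bigr do under eq_bigr do rewrite mulr_sumr.
  under [RHS]eq_bigr do rewrite exchange_big /=.
  rewrite exchange_big mulr_sumr /=; apply: eq_bigr => h Ph.
  have [_ ->] := dem_chord Ph; rewrite -/(dd _ _) mulrCA cut; last first.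
    by have /and5P[_ -> ->] := lohi Ph.
  rewrite mulr_sumr; apply: eq_bigr => g _; rewrite mulr_sumr; apply: eq_bigr => g' _.
  by rewrite /inside mulrnAr mulrnAr mulrC.
have QS i : 4 * (\sum_(C <- S i) C.2 * chord_dist C) = Q (chords_dist (S i)).
  rewrite /Q /chords_dist; under [RHS]eq_bigr do under eq_bigr do rewrite mulr_sumr.
  under [RHS]eq_bigr do rewrite exchange_big /=.
  rewrite exchange_big mulr_sumr /= big_seq [RHS]big_seq; apply: eq_bigr => C /okS h.
  rewrite /chord_dist -/(dd _ _) mulrCA cut //.
  rewrite mulr_sumr; apply: eq_bigr => g _; rewrite mulr_sumr; apply: eq_bigr => g' _.
  by rewrite /cut_off mulrnAr mulrnAr mulrC.
rewrite -(@ler_pM2l _ 4) // QP mulr_sumr (eq_bigr _ (fun i _ => QS i)).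
rewrite /Q [X in _ <= X]exchange_big /=; apply: ler_sum => g _; rewrite [X in _ <= X]exchange_big /=.
apply: ler_sum => g' _; rewrite -mulr_sumr.
(* On the diagonal [sw0] gives no sign for the weight, but both split distances vanish. *)
have [->|gg'] := eqVneq g g'.
  rewrite delta_diag big1 // => i _; apply: big1 => C _; by rewrite addbb.
apply: ler_wpM2l; first exact: sw0.
have covS x z : (x <= z)%N -> delta lo hi r P x z <= \sum_i chords_dist (S i) x z.
  move=> xz; apply: le_trans (cov x z xz) _.
  rewrite big_split_ord /=; apply: lerD; apply: ler_sum => i _.
    by have [_ _ /(_ x z xz) + _] := SP (lshift L.+1 i); rewrite /f /= ltn_ord.
  have [_ _ /(_ x z xz) + _] := SP (rshift L i).
  by rewrite /f /= ltnNge leq_addr /= addKn.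
have [le|lt] := leqP g g'; first exact: covS.
rewrite delta_sym; apply: le_trans (covS _ _ (ltnW lt)) _.
by apply: ler_sum => i _; apply: ler_sum => C _; rewrite addbC.
Qed.

End FaceCover.

Lemma crossing_symd (V : finType) (X Y : {set V}) uv :
  crossing (symd X Y) uv = crossing X uv (+) crossing Y uv.
Proof.
rewrite !crossingE !in_symd.
by case: (uv.1 \in X); case: (uv.2 \in X); case: (uv.1 \in Y); case: (uv.2 \in Y).
Qed.

(** A cut is split into a simple one [X1] and the rest [X2] with disjoint edge sets: capacities add
    up, and a pair separated by [X] is separated by one of the two. A cut without edges separates no
    pair, since each pair is joined. *)
Lemma simple_cuts_suffice (R : realFieldType) (V E I : finType) (ends : E -> V * V)
    (sigma : {perm E * bool}) (c : E -> R) (p : I -> V * V) (w : I -> R) :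
  planar_rotation ends sigma -> (forall i, 0 <= w i) ->
  (forall i, exists P, joins ends P (p i).1 (p i).2) ->
  (forall X : {set V},
     (forall d0, #|[set d in face sigma d0 | crossing X (ends d.1)]| <= 2)%N ->
     \sum_(i | crossing X (p i)) w i <= \sum_(e | crossing X (ends e)) c e) ->
  forall X : {set V}, \sum_(i | crossing X (p i)) w i <= \sum_(e | crossing X (ends e)) c e.
Proof.
move=> planar w0 jp simple X.
have [N] := ubnP #|[set e | crossing X (ends e)]|; elim: N X => // N IHN X; rewrite ltnS => le_N.
have [/existsP exX|noX] := boolP [exists e, crossing X (ends e)]; last first.
  rewrite big1 => [|i]; last first.
    have [P /joins_parP/(_ X)] := jp i; rewrite -crossingE => <-.
    rewrite /par big1 // => e _; apply/negbTE; apply: contra noX => /andP[_ eX].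
    by apply/existsP; exists e.
  rewrite big_pred0 // => e; apply/negbTE; apply: contra noX => eX.
  by apply/existsP; exists e.
have [X1 [sub [e1 e1X] X12]] := simple_dual_cut planar exX.
pose X2 := symd X X1.
have subX2 e : crossing X (ends e) = crossing X1 (ends e) || crossing X2 (ends e).
  by rewrite crossing_symd; have := sub e; case: (crossing X _); case: (crossing X1 _) => // /(_ isT).
have disj e : crossing X1 (ends e) -> crossing X2 (ends e) = false.
  by move=> eX1; rewrite crossing_symd eX1 sub.
have lt2 : (#|[set e | crossing X2 (ends e)]| < N)%N.
  apply: leq_trans le_N; apply/proper_card/properP; split.
    by apply/subsetP => e; rewrite !inE subX2 => ->; rewrite orbT.
  by exists e1; rewrite !inE ?sub // disj.
have -> : \sum_(e | crossing X (ends e)) c e =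
    \sum_(e | crossing X1 (ends e)) c e + \sum_(e | crossing X2 (ends e)) c e.
  rewrite (bigID (fun e => crossing X1 (ends e))) /=; congr (_ + _); apply: eq_bigl => e.
    by rewrite subX2; case: (crossing X1 _); rewrite ?andbT ?andbF.
  by rewrite subX2; have := disj e; case: (crossing X1 _) => [->|] //=; rewrite ?andbT ?orbF.
apply: le_trans (lerD (simple _ X12) (IHN _ lt2)).
rewrite [X in X <= _]big_mkcond [X in _ <= X + _]big_mkcond [X in _ <= _ + X]big_mkcond.
rewrite -big_split; apply: ler_sum => i _; rewrite crossing_symd.
by have := w0 i; case: (crossing X _); case: (crossing X1 _) => /=; lra.
Qed.

Lemma pairwise_flatten_map (I J : eqType) (T : I -> seq J) (rel : I * J -> I * J -> bool) (s : seq I) :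
  uniq s -> (forall i, i \in s -> pairwise (fun x y => rel (i, x) (i, y)) (T i)) ->
  (forall i j x y, i != j -> i \in s -> j \in s -> rel (i, x) (j, y)) ->
  pairwise rel [seq (i, x) | i <- s, x <- T i].
Proof.
elim: s => //= i s IHs /andP[is_ us] within across; rewrite pairwise_cat pairwise_map.
rewrite within ?inE ?eqxx //=; apply/andP; split; last first.
  apply: IHs => // [j js|j k x z jk js ks]; first by apply: within; rewrite inE js orbT.
  by apply: across; rewrite // inE ?js ?ks orbT.
apply/allrelP => _ _ /mapP[x _ ->] /allpairsPdep[j [z [js _ ->]]].
apply: across; rewrite ?inE ?eqxx ?js ?orbT //.
by apply: contraNneq is_ => ->.
Qed.

Section Main.
Variables (R : realFieldType) (V E D : finType) (ends : E -> V * V) (sigma : {perm E * bool}).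
Variables (dem : D -> V * V) (c : E -> R) (r : D -> R) (k : nat).
Hypothesis planar : planar_rotation ends sigma.
Hypothesis c0 : forall e, 0 <= c e.
Hypothesis r0 : forall h, 0 < r h.
Hypothesis cut : cut_condition ends dem c r.
Hypothesis cofacial : forall h, exists B : {set V},
  face_boundary ends sigma B /\ (dem h).1 \in B /\ (dem h).2 \in B.
Hypothesis few : forall B : {set V}, face_boundary ends sigma B ->
  (#|[set v in B | terminal dem v]| <= k)%N.

Local Notation dart := (E * bool)%type.
Local Notation fm := (facemap sigma).
Local Notation tails d0 := [set dtail ends d | d in face sigma d0].
Let L := up_log 2 k.

(** A face is represented by the canonical dart of its orbit, so that each demand is assigned to a
    single face. *)
Let base_ok h (d0 : dart) :=
  [&& fingraph.root (frel fm) d0 == d0, (dem h).1 \in tails d0 & (dem h).2 \in tails d0].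

(** Demands with equal endpoints have distance 0 and get no face; this also disposes of isolated
    vertices. *)
Let base h : option dart := if (dem h).1 == (dem h).2 then None else [pick d0 | base_ok h d0].

Let baseP h d0 : base h = Some d0 -> base_ok h d0.
Proof. by rewrite /base; case: ifP => // _; case: pickP => // d hd [<-]. Qed.

Let base_ex h : (dem h).1 != (dem h).2 -> exists d0, base h = Some d0.
Proof.
move=> st; have [B [[[F FF ->]|[v _ ->]] [sB tB]]] := cofacial h; last first.
  by case/negP: st; move: sB tB; rewrite !inE => /eqP -> /eqP ->.
rewrite /base (negPf st); case: pickP => [d0 _|none]; first by exists d0.
case/imsetP: FF => d _ FE; pose d0 := fingraph.root (frel fm) d.
have symf := fconnect_sym (@facemap_inj _ sigma).
have F0 : F = face sigma d0.
  by rewrite FE -/(face sigma d); apply/(face_eqP sigma); exact: connect_root.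
have := none d0; rewrite /base_ok /d0 (root_root symf) eqxx -/d0 -F0.
by rewrite sB tB.
Qed.

Section Lengths.
Variable len : E -> R.
Hypothesis len0 : forall e, 0 <= len e.
Local Notation dist := (dist ends len).

(** For each index [i] the chord systems numbered [i] of all faces form one noncrossing instance, to
    which [laminar_le] applies; there are [L + L.+1] indices. *)
Lemma demand_dist_le :
  \sum_h r h * dist (dem h).1 (dem h).2 <= (L + L.+1)%:R * \sum_e c e * len e.
Proof.
have r0' h : 0 <= r h by exact: ltW.
pose P d0 h := base h == Some d0.
have P_face d0 h : P d0 h -> ((dem h).1 \in tails d0) && ((dem h).2 \in tails d0).
  by move/eqP/baseP/andP => [].
have few_terminals d0 : (#|[set v in tails d0 | terminal dem v]| <= 2 ^ L)%N.
  apply: leq_trans (_ : k <= _)%N; last exact: up_logP.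
  by apply: few; left; exists (face sigma d0); rewrite ?face_in.
have /fin_all_exists[S SP] (d0 : dart) :=
  face_cover planar r0' len0 (P_face d0) (few_terminals d0).
pose roots := enum [pred d0 : dart | fingraph.root (frel fm) d0 == d0].
pose corn d0 g := corner ends sigma d0 g.
have rootsP d0 : (d0 \in roots) = (fingraph.root (frel fm) d0 == d0) by rewrite mem_enum inE.
have symf := fconnect_sym (@facemap_inj _ sigma).
have one_root d0 d1 : d0 \in roots -> d1 \in roots -> face sigma d0 = face sigma d1 -> d0 = d1.
  rewrite !rootsP => /eqP <- /eqP <- /(face_eqP sigma).
  by move=> /(fingraph.rootP symf); rewrite !(root_root symf).
have demands (F : D -> R) : (forall h, 0 <= F h) ->
    \sum_(d0 <- roots) \sum_(h | P d0 h) F h <= \sum_h F h.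
  move=> F0; rewrite (exchange_big_dep predT) //=; apply: ler_sum => h _.
  rewrite big_const_seq; case E0: (base h) => [d0|]; last first.
    by rewrite (eq_count (a2 := pred0)) ?count_pred0 //= => d; rewrite /P E0.
  rewrite (eq_count (a2 := pred1 d0)); last by move=> d; rewrite /P E0 /= eq_sym.
  rewrite count_uniq_mem ?enum_uniq //; case: (_ \in _) => //=; by rewrite addr0.
have level i : \sum_(d0 <- roots) \sum_(C <- S d0 i) C.2 * chord_dist ends sigma len d0 C <=
    \sum_e c e * len e.
  pose T := [seq (d0, C) | d0 <- roots, C <- S d0 i].
  pose x (j : 'I_(size T)) := tnth (in_tuple T) j.
  have sumT (F : dart * (nat * nat * R) -> R) :
      \sum_j F (x j) = \sum_(d0 <- roots) \sum_(C <- S d0 i) F (d0, C).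
    transitivity (\sum_(u <- T) F u); first by rewrite [RHS]big_tnth.
    by rewrite /T big_allpairs_dep.
  have inT j : ((x j).1 \in roots) /\ chord_ok (fingraph.order fm (x j).1) (x j).2.
    have : x j \in T by exact: mem_tnth.
    case/allpairsPdep => d0 [C [d0r CS ->]]; split=> //.
    by have [ok _ _ _] := SP d0; have /allP := ok i; apply.
  pose A j := face_arc sigma (x j).1 (x j).2.1.1 (x j).2.1.2.
  pose s j := corn (x j).1 (x j).2.1.1; pose t j := corn (x j).1 (x j).2.1.2.
  have bnd j : ((x j).2.1.1 <= (x j).2.1.2 < fingraph.order fm (x j).1)%N.
    by have [_ /and3P[h1 h2 _]] := inT j; rewrite (ltnW h1).
  have w0 j : 0 <= (x j).2.2 by have [_ /and3P[]] := inT j.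
  pose rel (u v : dart * (nat * nat * R)) :=
    (face_arc sigma v.1 v.2.1.1 v.2.1.2 \subset face_arc sigma u.1 u.2.1.1 u.2.1.2) ||
    [disjoint face_arc sigma v.1 v.2.1.1 v.2.1.2 & face_arc sigma u.1 u.2.1.1 u.2.1.2].
  have lamT : pairwise rel T.
    apply: pairwise_flatten_map => [|d0 _|d0 d1 C C' d01 d0r d1r]; first exact: enum_uniq.
      have [_ /(_ i) + _ _] := SP d0; apply: sub_pairwise => C C'.
      rewrite /laminar /rel /= => /or3P[/andP[h1 h2]|h|h].
      - apply/orP; left; apply/subsetP => d; rewrite !inE => /and3P[-> h3 h4] /=.
        by rewrite (leq_ltn_trans h1 h3) (leq_trans h4 h2).
      - apply/orP; right; apply/pred0P => d /=; rewrite !inE; apply/negbTE.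
        by apply/negP => /andP[/and3P[_ h3 h4] /and3P[_ h5 h6]]; lia.
      apply/orP; right; apply/pred0P => d /=; rewrite !inE; apply/negbTE.
      by apply/negP => /andP[/and3P[_ h3 h4] /and3P[_ h5 h6]]; lia.
    apply/orP; right; apply/pred0P => d /=; apply/negbTE; apply: contra d01.
    by case/andP => /arc_face e1 /arc_face e0; apply/eqP/one_root; rewrite // -e0 -e1.
  have := @laminar_le R V E ends sigma planar (size T) A
    (fun j => iter (x j).2.1.1.+1 fm (x j).1) s t _ _ _ _ c len (fun j => (x j).2.2)
    (fun j => dist (s j) (t j)) c0 w0 len0.
  rewrite (sumT (fun u => u.2.2 * dist (corn u.1 u.2.1.1) (corn u.1 u.2.1.2))).
  apply.
  - move=> j; have [_ /and3P[h1 h2 _]] := inT j.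
    by rewrite mem_arc ?(leq_ltn_trans h1) // ltnS leqnn.
  - by move=> j d d' /arc_face -> /arc_face ->.
  - move=> j1 j2 lt; have /(pairwiseP (x j1)) := lamT; move=> /(_ j1 j2).
    by rewrite !inE !ltn_ord -!(tnth_nth (x j1) (in_tuple T)) => /(_ isT isT lt).
  - by move=> j X; exact: arc_boundary.
  (* Only cuts crossing each face at most twice need testing; for these [face_cover] compares the
     chords of each face with its demands. *)
  - apply: (simple_cuts_suffice (p := fun j => (s j, t j)) planar w0).
      by move=> j; exists (arc_edges sigma (x j).1 (x j).2.1.1 (x j).2.1.2); exact: arc_joins.
    move=> X X2; apply: le_trans (cut X); rewrite big_mkcond [X in _ <= X]big_mkcond.
    apply: le_trans (demands (fun h => if crossing X (dem h) then r h else 0) _).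
      rewrite (sumT (fun u => if crossing X (corn u.1 u.2.1.1, corn u.1 u.2.1.2) then u.2.2 else 0)).
      apply: ler_sum => d0 _; have [_ _ /(_ i X (X2 d0)) + _] := SP d0.
      by congr (_ <= _); apply: eq_bigr => ? _; rewrite ?/chord_sep; case: ifP.
    by move=> h; case: ifP.
  - by move=> j Q jQ; exact: dist_le.
apply: (@le_trans _ _ (\sum_(d0 <- roots) \sum_(h | P d0 h) r h * dist (dem h).1 (dem h).2)).
  rewrite (exchange_big_dep predT) //=; apply: ler_sum => h _.
  have F0 : 0 <= r h * dist (dem h).1 (dem h).2 by rewrite mulr_ge0 // dist_ge0.
  have [e|/base_ex[d0 bh]] := eqVneq (dem h).1 (dem h).2.
    by rewrite {1}e dist_diag // mulr0 sumr_ge0.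
  have /and3P[d0r _ _] := baseP bh.
  rewrite big_mkcond (bigD1_seq d0) ?rootsP ?enum_uniq //= {1}/P bh eqxx.
  by rewrite lerDl sumr_ge0 // => d _; case: ifP.
apply: (@le_trans _ _ (\sum_(d0 <- roots) \sum_i \sum_(C <- S d0 i) C.2 * chord_dist ends sigma len d0 C)).
  by apply: ler_sum => d0 _; have [] := SP d0.
rewrite exchange_big /= mulr_natl -[X in _ *+ X]card_ord -sumr_const.
by apply: ler_sum => i _; exact: level.
Qed.

End Lengths.

Lemma planar_congestion : routable ends dem c r (2 * up_log 2 k + 2)%:R.
Proof.
apply: routable_dual => u len len0 u_le.
(* The duality argument yields the factor [2 L + 1], one below the bound claimed. *)
apply: le_trans (_ : (L + L.+1)%:R * \sum_e c e * len e <= _); last first.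
  apply: ler_wpM2r; first by apply: sumr_ge0 => e _; rewrite mulr_ge0.
  by rewrite ler_nat /L; lia.
apply: le_trans (demand_dist_le len0); apply: ler_sum => h _.
rewrite ler_pM2l //.
have [Q jQ] : exists Q, joins ends Q (dem h).1 (dem h).2.
  have [->|/base_ex[d0 /baseP/and3P[_ sd td]]] := eqVneq (dem h).1 (dem h).2.
    by exists set0; exact: joins0.
  have [n1 c1] := corner_indexP planar sd; have [n2 c2] := corner_indexP planar td.
  rewrite -c1 -c2; set i := corner_index _ _ _ _ in n1 *; set j := corner_index _ _ _ _ in n2 *.
  have [ij|/ltnW ij] := leqP i j.
    by exists (arc_edges sigma d0 i j); apply: arc_joins; rewrite ?ij.
  by exists (arc_edges sigma d0 j i); rewrite joins_sym; apply: arc_joins; rewrite ?ij.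
have [Q' jQ' ->] := dist_attained len0 jQ.
have [p st le_p] := joins_stpath len0 jQ'.
exact: le_trans (u_le h p st) le_p.
Qed.

End Main.

Unset Implicit Arguments. Set Strict Implicit. Set Printing Implicit Defensive.

Theorem theorem1 (R : realFieldType) (V E D : finType)
  (ends : E -> V * V) (sigma : {perm E * bool}) (dem : D -> V * V)
  (c : E -> R) (r : D -> R) (k : nat) :
  planar_rotation ends sigma ->
  (1 <= k)%N ->
  (forall e, 0 <= c e) ->
  (forall h, 0 < r h) ->
  cut_condition ends dem c r ->
  (forall h, exists B : {set V},
     face_boundary ends sigma B /\ (dem h).1 \in B /\ (dem h).2 \in B) ->
  (forall B : {set V}, face_boundary ends sigma B ->
     (#|[set v in B | terminal dem v]| <= k)%N) ->
  routable ends dem c r (2 * up_log 2 k + 2)%:R.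
Proof.
by move=> planar _ c0 r0 cut cofacial few; exact: planar_congestion planar c0 r0 cut cofacial few.
Qed.
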